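(* Fix any $\lambda\in\mathbb{R}$. (i) There is a $4$-parameter family of $\mathrm{SU}(3)$-invariant Laplacian solitons with dilation constant $\lambda$, each defined on $(-\epsilon,0)\times \mathrm{SU}(3)/T^2$ for some $\epsilon>0$, such that (with $\{i,j,k\}=\{1,2,3\}$) $f_k\to0$ as $t\to0$ with $f_k=O(\sqrt{-t})$, while $\frac{f_i}{f_j}$ and $f_1f_2f_3$ converge to positive limits as $t\to0$. (ii) A $2$-parameter subfamily has $f_2=f_3$ and thus defines $\mathrm{Sp}(2)$-invariant Laplacian solitons with dilation constant $\lambda$ on $(-\epsilon,0)\times\mathbb{CP}^3$.
   Context: A Laplacian soliton on a 7-manifold is a triple $(\varphi,X,\lambda)$ with $\varphi$ a $G_2$-structure, $X$ a vector field, $\lambda\in\mathbb{R}$ (the dilation constant), such that $d\varphi=0$ and $\Delta_\varphi\varphi=\lambda\varphi+\mathcal{L}_X\varphi$. $\mathrm{SU}(3)$-invariant solitons on $I\times \mathrm{SU}(3)/T^2$ are (up to discrete symmetries) given by functions $f_1,f_2,f_3:I\to(0,\infty)$, $u:I\to\mathbb{R}$ satisfying $2(f_1f_2f_3)'=f_1^2+f_2^2+f_3^2$, $\;(\tau_i-uf_i^2)'=\lambda f_i^2$ for $i=1,2,3$, and $\tau_1+\tau_2+\tau_3=u(f_1^2+f_2^2+f_3^2)+2\lambda f_1f_2f_3$, where $\tau_i:=(f_i^2)'+\frac{f_i^2}{f_1f_2f_3}\bigl(2f_i^2-(f_1^2+f_2^2+f_3^2)\bigr)$. Here $X=u\,\partial_t$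 and the metric is $dt^2+\sum f_i^2g_i$ with $g_i$ the invariant metrics on the three irreducible summands of the isotropy representation. $\mathrm{Sp}(2)$-invariant solitons on $I\times\mathbb{CP}^3$, $\mathbb{CP}^3=\mathrm{Sp}(2)/(\mathrm{Sp}(1)\times \mathrm{U}(1))$, are given by the same system with $f_2=f_3$, $\tau_2=\tau_3$. The system is symmetric under permutations of the indices $1,2,3$. *)

(* Defs.v *)
From Stdlib Require Import Reals.
From Coquelicot Require Import Coquelicot.
Open Scope R_scope.

(** Labels of the three irreducible summands of the isotropy representation. *)
Inductive index : Set := One | Two | Three.

Definition vol (f : index -> R -> R) (t : R) : R :=
  f One t * f Two t * f Three t.

Definition sqsum (f : index -> R -> R) (t : R) : R :=
  f One t ^ 2 + f Two t ^ 2 + f Three t ^ 2.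

Definition tau (f : index -> R -> R) (i : index) (t : R) : R :=
  Derive (fun s => f i s ^ 2) t
  + f i t ^ 2 / vol f t * (2 * f i t ^ 2 - sqsum f t).

Definition smooth_on (a b : R) (g : R -> R) : Prop :=
  forall (n : nat) (t : R), a < t < b -> ex_derive_n g n t.

(** [(f, u)] is an SU(3)-invariant Laplacian soliton with dilation constant
    [lambda] on (a, b) x SU(3)/T^2: the metric is dt^2 + sum_i f_i^2 g_i and
    the vector field is u d/dt. [soliton_closed] is closedness of the 3-form;
    the remaining equations are the soliton equation written with the torsion
    components tau_i. Only values on (a, b) matter, and smoothness there makes
    every [Derive] a true derivative. *)
Record SU3_soliton (lambda a b : R) (f : index -> R -> R) (u : R -> R) : Prop := {
  soliton_pos : forall i t, a < t < b -> 0 < f i t;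
  soliton_smooth_f : forall i, smooth_on a b (f i);
  soliton_smooth_u : smooth_on a b u;
  soliton_closed : forall t, a < t < b -> 2 * Derive (vol f) t = sqsum f t;
  soliton_evolution : forall i t, a < t < b ->
    Derive (fun s => tau f i s - u s * f i s ^ 2) t = lambda * f i t ^ 2;
  soliton_conservation : forall t, a < t < b ->
    tau f One t + tau f Two t + tau f Three t
    = u t * sqsum f t + 2 * lambda * vol f t
}.

(** Sp(2)-invariant Laplacian solitons on (a, b) x CP^3. *)
Definition Sp2_soliton (lambda a b : R) (f : index -> R -> R) (u : R -> R) : Prop :=
  SU3_soliton lambda a b f u /\
  forall t, a < t < b -> f Two t = f Three t /\ tau f Two t = tau f Three t.

(** Behaviour at the end t -> 0-, with [k] the direction that collapses. *)
Definition collapses_at_0 (k : index) (f : index -> R -> R) : Prop :=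
  filterlim (f k) (at_left 0) (locally 0) /\
  (exists C : R, at_left 0 (fun t => Rabs (f k t) <= C * sqrt (- t))) /\
  (forall i j : index, i <> j -> i <> k -> j <> k ->
     exists l : R, 0 < l /\
       filterlim (fun t => f i t / f j t) (at_left 0) (locally l)) /\
  (exists l : R, 0 < l /\ filterlim (vol f) (at_left 0) (locally l)).

(** Pairs [(f p, u p)] on the intervals (- fam_eps p, 0), for parameters [p] in the
    set [params]; values for [p] outside [params] or [t] outside the interval are
    irrelevant. *)
Record soliton_family (P : UniformSpace) : Type := {
  params : P -> Prop;
  fam_eps : P -> R;
  fam_f : P -> index -> R -> R;
  fam_u : P -> R -> R
}.
Arguments params {P} _ _.
Arguments fam_eps {P} _ _.
Arguments fam_f {P} _ _ _ _.
Arguments fam_u {P} _ _ _.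

Definition total_domain {P : UniformSpace} (F : soliton_family P) (q : P * R) : Prop :=
  params F (fst q) /\ - fam_eps F (fst q) < snd q < 0.

(** What makes a family over a parameter space of dimension n a genuine
    n-parameter family: the parameters fill a nonempty open set, the functions
    depend continuously on them (jointly with [t]), and distinct parameters
    give pairs that differ arbitrarily close to t = 0. *)
Record is_parameter_family {P : UniformSpace} (F : soliton_family P) : Prop := {
  family_open : open (params F);
  family_nonempty : exists p, params F p;
  family_eps_pos : forall p, params F p -> 0 < fam_eps F p;
  family_total_open : open (total_domain F);
  family_continuous_f : forall (i : index) (q : P * R), total_domain F q ->
    continuous (fun q : P * R => fam_f F (fst q) i (snd q)) q;
  family_continuous_u : forall q : P * R, total_domain F q ->
    continuous (fun q : P * R => fam_u F (fst q) (snd q)) q;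
  family_injective : forall p p', params F p -> params F p' ->
    at_left 0 (fun t => (forall i, fam_f F p i t = fam_f F p' i t) /\
                        fam_u F p t = fam_u F p' t) ->
    p = p'
}.

Definition reparametrize {P Q : UniformSpace} (F : soliton_family P)
    (V : Q -> Prop) (j : Q -> P) : soliton_family Q :=
  {| params := V;
     fam_eps := fun v => fam_eps F (j v);
     fam_f := fun v => fam_f F (j v);
     fam_u := fun v => fam_u F (j v) |}.

Definition R2 : UniformSpace := prod_UniformSpace R_UniformSpace R_UniformSpace.
Definition R4 : UniformSpace := prod_UniformSpace R2 R2.

(* Main.v *)
(* Put x_i = f_i^2, w_i = tau_i - u x_i, S = x_1 + x_2 + x_3 and V = f_1 f_2 f_3. The
   soliton system then reads x_i' = w_i + u x_i - x_i (2 x_i - S) / V, w_i' = lambda x_i;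
   closedness becomes w_1/x_1 + w_2/x_2 + w_3/x_3 + 3u = 0, which gives u, and the
   conservation law becomes w_1 + w_2 + w_3 = 2 lambda V. Written in the variables f_1, V,
   rho = f_2/f_3, w_1, w_2 - w_3 and in the time r with dt = f_1 dr, the equations stay
   regular at f_1 = 0, where df_1/dr = w_1/3. So every initial state with f_1 = 0,
   V, rho > 0 and w_1 < 0 gives a solution with f_1 > 0 for r < 0; since t' = f_1 is
   comparable to -r, t is comparable to -r^2, whence f_1 = O(sqrt (-t)). The four
   parameters are the initial values of V, rho, w_1 and w_2 - w_3; exchanging the second
   and third summands shows that f_2 = f_3 amounts to rho = 1 and w_2 = w_3. *)
Require Import Defs.
From Stdlib Require Import Reals Lra Lia ClassicalEpsilon.
From Coquelicot Require Import Coquelicot.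
Open Scope R_scope.

(** * Flow of a Lipschitz vector field *)

(** Since dt/dr = f_1 vanishes at r = 0, the inverse function theorem fails exactly at the end that
    matters, where r behaves like a square root of -t. A weighted bound is used instead: r^2 is
    Lipschitz in t and in the parameters together. For this, t is carried as one more coordinate of
    the state, so that the Lipschitz estimate of the flow covers it too. A family asks only for
    continuity in its parameters, so Lipschitz dependence suffices. It is proved for the Picard
    iterates, with constants free of their number, and passes to the limit. That rho = 1 and w_2 =
    w_3 persist is also checked on the iterates, instead of by uniqueness of solutions. Distinct
    parameters are separated because f and u determine the state (apart from t) near the end, and
    the state tends to its initial value. An open set of parameters is enough, so everything happens
    near one state, V = rho = 1, w_1 = -3, w_2 = w_3. In a small box around it V and rho stay away
    from 0 and df_1/dr is at most -1/2, which gives one time interval for all parameters. *)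

Definition sup_close {I : Type} (d : R) (y z : I -> R) : Prop :=
  forall j, Rabs (y j - z j) <= d.

Lemma sup_close_refl {I : Type} (y : I -> R) : sup_close 0 y y.
Proof. intros j. rewrite Rminus_diag, Rabs_R0. lra. Qed.

Definition bounded_by {I : Type} (M : R) (F : I -> (I -> R) -> R) : Prop :=
  forall i y, Rabs (F i y) <= M.

(** Here [d] is any common bound for the coordinate differences, so the sup norm on [I -> R] is used
    without forming a supremum. *)
Definition lipschitz {I : Type} (L : R) (F : I -> (I -> R) -> R) : Prop :=
  forall i y z d, sup_close d y z -> Rabs (F i y - F i z) <= L * d.

Lemma abs_RInt_le (f : R -> R) (a b M : R) :
  ex_RInt f a b ->
  (forall t, Rmin a b <= t <= Rmax a b -> Rabs (f t) <= M) ->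
  Rabs (RInt f a b) <= M * Rabs (b - a).
Proof.
  intros Hf HM. destruct (Rle_dec a b) as [H|H].
  - rewrite Rmin_left, Rmax_right in HM by lra.
    rewrite (Rabs_pos_eq (b - a)) by lra. rewrite Rmult_comm.
    now apply abs_RInt_le_const.
  - rewrite Rmin_right, Rmax_left in HM by lra.
    rewrite <- (opp_RInt_swap f) by now apply ex_RInt_swap.
    change (Rabs (- RInt f b a) <= M * Rabs (b - a)).
    rewrite Rabs_Ropp, (Rabs_left (b - a)), Rmult_comm by lra.
    replace (- (b - a)) with (a - b) by ring.
    apply abs_RInt_le_const; [lra | now apply ex_RInt_swap | exact HM].
Qed.

Lemma lipschitz_continuous (C : R) (f : R -> R) (x : R) :
  (forall s s', Rabs (f s - f s') <= C * Rabs (s - s')) -> continuous f x.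
Proof.
  intros Hf. apply continuity_pt_filterlim. intros e He.
  exists (e / (Rabs C + 1)). pose proof (Rabs_pos C).
  split; [apply Rdiv_lt_0_compat; lra|].
  intros s [_ Hs]. unfold dist in *; simpl in *. unfold R_dist in *.
  apply Rle_lt_trans with ((Rabs C + 1) * Rabs (s - x)).
  - eapply Rle_trans; [apply Hf|]. apply Rmult_le_compat_r; [apply Rabs_pos|].
    pose proof (Rle_abs C); lra.
  - apply Rmult_lt_compat_l with (r := Rabs C + 1) in Hs; [|lra].
    replace ((Rabs C + 1) * (e / (Rabs C + 1))) with e in Hs by (field; lra).
    exact Hs.
Qed.

Fixpoint picard {I : Type} (F : I -> (I -> R) -> R) (n : nat) (y0 : I -> R)
    (r : R) (i : I) : R :=
  match n with
  | O => y0 i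
  | S n => y0 i + RInt (fun s => F i (picard F n y0 s)) 0 r
  end.

Lemma lipschitz_curve_continuous {I : Type} (F : I -> (I -> R) -> R) (M L : R)
    (c : R -> I -> R) :
  lipschitz L F ->
  (forall r r', sup_close (M * Rabs (r - r')) (c r) (c r')) ->
  forall i x, continuous (fun s => F i (c s)) x.
Proof.
  intros HL Hc i x. apply (lipschitz_continuous (L * M)). intros s s'.
  rewrite Rmult_assoc. apply HL, Hc.
Qed.

Lemma lipschitz_curve_integrable {I : Type} (F : I -> (I -> R) -> R) (M L : R)
    (c : R -> I -> R) :
  lipschitz L F ->
  (forall r r', sup_close (M * Rabs (r - r')) (c r) (c r')) ->
  forall i x y, ex_RInt (fun s => F i (c s)) x y.
Proof.
  intros HL Hc i x y. apply (ex_RInt_continuous (V := R_CompleteNormedModule)).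
  intros z _. now apply (lipschitz_curve_continuous F M L).
Qed.

Lemma RInt_increment_le (f : R -> R) (M r r' : R) :
  (forall x y, ex_RInt f x y) -> (forall t, Rabs (f t) <= M) ->
  Rabs (RInt f 0 r - RInt f 0 r') <= M * Rabs (r - r').
Proof.
  intros Hf HM.
  rewrite <- (RInt_Chasles f 0 r' r) by apply Hf.
  change (plus (RInt f 0 r') (RInt f r' r)) with (RInt f 0 r' + RInt f r' r).
  rewrite Rplus_minus_l.
  apply abs_RInt_le; auto.
Qed.

Lemma RInt_difference_le (f g : R -> R) (C r : R) :
  ex_RInt f 0 r -> ex_RInt g 0 r ->
  (forall t, Rabs t <= Rabs r -> Rabs (f t - g t) <= C) ->
  Rabs (RInt f 0 r - RInt g 0 r) <= C * Rabs r.
Proof.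
  intros Hf Hg HC.
  change (RInt f 0 r - RInt g 0 r) with (minus (RInt f 0 r) (RInt g 0 r)).
  rewrite <- (RInt_minus f g) by assumption.
  rewrite <- (Rminus_0_r r) at 2.
  apply abs_RInt_le; [now apply (ex_RInt_minus (V := R_NormedModule))|].
  intros t Ht. apply HC. revert Ht.
  unfold Rmin, Rmax, Rabs. destruct (Rle_dec 0 r), (Rcase_abs t), (Rcase_abs r); lra.
Qed.

(** The constant is the bound [M] of the field, whatever [n]; the induction hypothesis serves to
    make the next integrand continuous, hence integrable. *)
Lemma picard_time_lipschitz {I : Type} (F : I -> (I -> R) -> R) (M L : R) n y0 :
  0 <= M -> bounded_by M F -> lipschitz L F ->
  forall r r', sup_close (M * Rabs (r - r')) (picard F n y0 r) (picard F n y0 r').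
Proof.
  intros HM HB HL. induction n as [|n IH]; intros r r' i; simpl.
  - rewrite Rminus_diag, Rabs_R0. apply Rmult_le_pos; [lra | apply Rabs_pos].
  - rewrite Rminus_plus_l_l.
    apply RInt_increment_le; [|intros t; apply HB].
    now apply (lipschitz_curve_integrable F M L).
Qed.

(** Integration over a length of at most [a] contracts the sup distance by the factor
    [L * a <= / 2]; the first step moves by at most [M * a]. *)
Lemma picard_step {I : Type} (F : I -> (I -> R) -> R) (M L a : R) n y0 r :
  0 <= M -> bounded_by M F -> lipschitz L F -> 0 <= L -> L * a <= / 2 ->
  Rabs r <= a ->
  sup_close (M * a * (/ 2) ^ n) (picard F (S n) y0 r) (picard F n y0 r).
Proof.
  intros HM HB HL HL0 Ha. revert r. induction n as [|n IH]; intros r Hr i.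
  - simpl. rewrite Rplus_minus_l.
    rewrite Rmult_1_r. apply Rle_trans with (M * Rabs (r - 0)).
    + apply abs_RInt_le; [|intros t _; apply HB].
      apply (lipschitz_curve_integrable F M L _ HL).
      intros s s' j. rewrite Rminus_diag, Rabs_R0.
      apply Rmult_le_pos; [lra | apply Rabs_pos].
    + rewrite Rminus_0_r. now apply Rmult_le_compat_l.
  - change (Rabs (y0 i + RInt (fun s => F i (picard F (S n) y0 s)) 0 r
              - (y0 i + RInt (fun s => F i (picard F n y0 s)) 0 r))
            <= M * a * (/ 2) ^ S n).
    rewrite Rminus_plus_l_l.
    pose proof (Rabs_pos r).
    assert (Hp : 0 <= M * a * (/ 2) ^ n).
    { apply Rmult_le_pos; [apply Rmult_le_pos; lra | apply pow_le; lra]. }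
    apply Rle_trans with (L * (M * a * (/ 2) ^ n) * Rabs r).
    + apply RInt_difference_le.
      * apply (lipschitz_curve_integrable F M L _ HL).
        now apply (picard_time_lipschitz F M L (S n)).
      * apply (lipschitz_curve_integrable F M L _ HL).
        now apply (picard_time_lipschitz F M L n).
      * intros t Ht. apply HL, IH. lra.
    + simpl. apply Rle_trans with (L * a * (M * a * (/ 2) ^ n)).
      * replace (L * a * (M * a * (/ 2) ^ n)) with (L * (M * a * (/ 2) ^ n) * a) by ring.
        apply Rmult_le_compat_l; [now apply Rmult_le_pos | lra].
      * apply Rmult_le_compat_r with (r := M * a * (/ 2) ^ n) in Ha; lra.
Qed.

Lemma Rabs_minus_triang (x y z : R) : Rabs (x - z) <= Rabs (x - y) + Rabs (y - z).
Proof. replace (x - z) with ((x - y) + (y - z)) by ring. apply Rabs_triang. Qed.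

Lemma picard_tail {I : Type} (F : I -> (I -> R) -> R) (M L a : R) n m y0 r :
  0 <= M -> bounded_by M F -> lipschitz L F -> 0 <= L -> L * a <= / 2 ->
  Rabs r <= a ->
  sup_close (2 * (M * a) * (/ 2) ^ n) (picard F (n + m) y0 r) (picard F n y0 r).
Proof.
  intros HM HB HL HL0 Ha Hr i.
  assert (Hp : 0 <= M * a).
  { apply Rmult_le_pos; [lra|]. pose proof (Rabs_pos r); lra. }
  (* The geometric series is kept in telescoped form: the bound without the subtracted term would
     not survive the induction on [m]. *)
  assert (H : Rabs (picard F (n + m) y0 r i - picard F n y0 r i)
              <= 2 * (M * a) * ((/ 2) ^ n - (/ 2) ^ (n + m))).
  { induction m as [|m IH].
    - rewrite Nat.add_0_r, !Rminus_diag, Rabs_R0, Rmult_0_r. lra.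
    - rewrite Nat.add_succ_r.
      pose proof (picard_step F M L a (n + m) y0 r HM HB HL HL0 Ha Hr i) as Hs.
      pose proof (Rabs_minus_triang (picard F (S (n + m)) y0 r i)
                    (picard F (n + m) y0 r i) (picard F n y0 r i)).
      simpl (_ ^ S _). lra. }
  assert (0 <= (/ 2) ^ (n + m)) by (apply pow_le; lra).
  assert (0 <= M * a * (/ 2) ^ (n + m)) by now apply Rmult_le_pos.
  lra.
Qed.

(** The factor 2 reproduces itself under one iteration, [d + L * (2 * d) * a <= 2 * d]. This takes
    the place of a Gronwall estimate. *)
Lemma picard_initial_lipschitz {I : Type} (F : I -> (I -> R) -> R) (M L a : R) n :
  0 <= M -> bounded_by M F -> lipschitz L F -> 0 <= L -> L * a <= / 2 ->
  forall y0 z0 d r, sup_close d y0 z0 -> Rabs r <= a ->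
  sup_close (2 * d) (picard F n y0 r) (picard F n z0 r).
Proof.
  intros HM HB HL HL0 Ha y0 z0 d r Hd. revert r. induction n as [|n IH]; intros r Hr i.
  all: assert (0 <= d) by (pose proof (Hd i); pose proof (Rabs_pos (y0 i - z0 i)); lra).
  - simpl. pose proof (Hd i). lra.
  - simpl.
    assert (Rabs (RInt (fun s => F i (picard F n y0 s)) 0 r
                  - RInt (fun s => F i (picard F n z0 s)) 0 r) <= L * (2 * d) * Rabs r).
    { apply RInt_difference_le.
      1,2: apply (lipschitz_curve_integrable F M L _ HL);
           now apply (picard_time_lipschitz F M L n).
      intros t Ht. apply HL, IH. lra. }
    assert (L * (2 * d) * Rabs r <= d).
    { apply Rle_trans with (L * (2 * d) * a).
      - apply Rmult_le_compat_l; [apply Rmult_le_pos|]; lra.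
      - apply Rmult_le_compat_r with (r := 2 * d) in Ha; lra. }
    pose proof (Hd i).
    match goal with |- Rabs (_ + ?x - (_ + ?y)) <= _ =>
      replace (y0 i + x - (z0 i + y)) with ((y0 i - z0 i) + (x - y)) by (simpl; ring) end.
    eapply Rle_trans; [apply Rabs_triang|]. simpl in *. lra.
Qed.

(** Persistence of a constraint is verified on the iterates, whose integrands vanish in the
    coordinates of [K]; this stands in for a uniqueness theorem. *)
Lemma picard_invariant {I : Type} (F : I -> (I -> R) -> R) (K : I -> Prop)
    (c : I -> R) n y0 :
  (forall y, (forall i, K i -> y i = c i) -> forall i, K i -> F i y = 0) ->
  (forall i, K i -> y0 i = c i) ->
  forall r i, K i -> picard F n y0 r i = c i.
Proof.
  intros HF H0. induction n as [|n IH]; intros r i Hi; simpl; [auto|].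
  rewrite (RInt_ext _ (fun _ => 0)) by (intros; apply HF; auto).
  rewrite RInt_const, H0 by assumption.
  change (c i + (r - 0) * 0 = c i). ring.
Qed.

Lemma geometric_small (C e : R) : 0 < e -> exists n, C * (/ 2) ^ n < e.
Proof.
  intros He.
  assert (Hl : is_lim_seq (fun n => C * (/ 2) ^ n) (C * 0)).
  { apply (is_lim_seq_scal_l _ C 0), is_lim_seq_geom.
    rewrite Rabs_pos_eq; lra. }
  apply is_lim_seq_spec in Hl. destruct (Hl (mkposreal e He)) as [n Hn].
  exists n. specialize (Hn n (Nat.le_refl n)). simpl in Hn.
  rewrite Rmult_0_r, Rminus_0_r in Hn.
  pose proof (Rle_abs (C * (/ 2) ^ n)); lra.
Qed.

(** * Passage to the limit in the Picard iteration *)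

Definition clamp (a x : R) : R := Rmax (- a) (Rmin a x).

Ltac clamp_cases :=
  unfold clamp, Rmin, Rmax, Rabs;
  repeat match goal with
    | |- context [Rle_dec ?x ?y] =>
        lazymatch constr:((x, y)) with
        | context [Rle_dec _ _] => fail
        | _ => destruct (Rle_dec x y)
        end
    | |- context [Rcase_abs ?x] =>
        lazymatch x with
        | context [Rle_dec _ _] => fail
        | _ => destruct (Rcase_abs x)
        end
    end; lra.

Lemma clamp_id (a x : R) : Rabs x <= a -> clamp a x = x.
Proof. clamp_cases. Qed.

Lemma clamp_abs (a x : R) : 0 <= a -> Rabs (clamp a x) <= a.
Proof. clamp_cases. Qed.

Lemma clamp_lipschitz (a x y : R) : 0 <= a -> Rabs (clamp a x - clamp a y) <= Rabs (x - y).
Proof. clamp_cases. Qed.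

(* The iterates are only known to converge for |r| <= a; clamping r makes the limit
   globally Lipschitz. *)
Definition flow {I : Type} (F : I -> (I -> R) -> R) (a : R) (y0 : I -> R) (r : R)
    (i : I) : R :=
  real (Lim_seq (fun n => picard F n y0 (clamp a r) i)).

Lemma flow_limit {I : Type} (F : I -> (I -> R) -> R) (M L a : R) y0 r i :
  0 <= a -> 0 <= M -> bounded_by M F -> lipschitz L F -> 0 <= L -> L * a <= / 2 ->
  is_lim_seq (fun n => picard F n y0 (clamp a r) i) (flow F a y0 r i).
Proof.
  intros Ha0 HM HB HL HL0 Ha. apply Lim_seq_correct', ex_lim_seq_cauchy_corr.
  intros e. destruct (geometric_small (4 * (M * a)) e (cond_pos e)) as [N HN].
  exists N. intros n m Hn Hm.
  pose proof (picard_tail F M L a N (n - N) y0 _ HM HB HL HL0 Ha (clamp_abs a r Ha0) i) as Hn'.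
  pose proof (picard_tail F M L a N (m - N) y0 _ HM HB HL HL0 Ha (clamp_abs a r Ha0) i) as Hm'.
  replace (N + (n - N))%nat with n in Hn' by lia.
  replace (N + (m - N))%nat with m in Hm' by lia.
  rewrite Rabs_minus_sym in Hm'.
  eapply Rle_lt_trans; [apply Rabs_minus_triang with (y := picard F N y0 (clamp a r) i)|].
  lra.
Qed.

Lemma is_lim_seq_abs_minus_le (u v : nat -> R) (l l' C : R) :
  is_lim_seq u l -> is_lim_seq v l' -> (forall n, Rabs (u n - v n) <= C) ->
  Rabs (l - l') <= C.
Proof.
  intros Hu Hv HC.
  apply (is_lim_seq_le (fun n => Rabs (u n - v n)) (fun _ => C)
           (Rabs (l - l')) C HC); [|apply is_lim_seq_const].
  apply (is_lim_seq_abs _ (Finite (l - l'))), (is_lim_seq_minus' u v); assumption.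
Qed.

Lemma flow_lipschitz {I : Type} (F : I -> (I -> R) -> R) (M L a : R) :
  0 <= a -> 0 <= M -> bounded_by M F -> lipschitz L F -> 0 <= L -> L * a <= / 2 ->
  forall y0 z0 d r r', sup_close d y0 z0 ->
  sup_close (2 * d + M * Rabs (r - r')) (flow F a y0 r) (flow F a z0 r').
Proof.
  intros Ha0 HM HB HL HL0 Ha y0 z0 d r r' Hd i.
  apply (is_lim_seq_abs_minus_le _ _ _ _ _
           (flow_limit F M L a y0 r i Ha0 HM HB HL HL0 Ha)
           (flow_limit F M L a z0 r' i Ha0 HM HB HL HL0 Ha)).
  intros n. eapply Rle_trans;
    [apply Rabs_minus_triang with (y := picard F n z0 (clamp a r) i)|].
  apply Rplus_le_compat.
  - apply (picard_initial_lipschitz F M L a n HM HB HL HL0 Ha); auto using clamp_abs.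
  - eapply Rle_trans; [now apply (picard_time_lipschitz F M L n z0)|].
    apply Rmult_le_compat_l; [lra | now apply clamp_lipschitz].
Qed.

Lemma flow_picard_close {I : Type} (F : I -> (I -> R) -> R) (M L a : R) n y0 r :
  0 <= a -> 0 <= M -> bounded_by M F -> lipschitz L F -> 0 <= L -> L * a <= / 2 ->
  Rabs r <= a ->
  sup_close (2 * (M * a) * (/ 2) ^ n) (flow F a y0 r) (picard F n y0 r).
Proof.
  intros Ha0 HM HB HL HL0 Ha Hr i.
  pose proof (flow_limit F M L a y0 r i Ha0 HM HB HL HL0 Ha) as Hl.
  rewrite clamp_id in Hl by assumption.
  apply (is_lim_seq_incr_n _ n) in Hl.
  apply (is_lim_seq_abs_minus_le _ _ _ _ _ Hl
           (is_lim_seq_const (picard F n y0 r i))).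
  intros m. rewrite Nat.add_comm. now apply (picard_tail F M L a).
Qed.

(** The flow is compared with the iterate of index [S n]: its distance to that iterate and the
    change of the integral are each at most half of [2 * (M * a) * (/ 2) ^ n], so the two sides
    differ by less than any [e]. *)
Lemma flow_equation {I : Type} (F : I -> (I -> R) -> R) (M L a : R) y0 r i :
  0 <= a -> 0 <= M -> bounded_by M F -> lipschitz L F -> 0 <= L -> L * a <= / 2 ->
  Rabs r <= a ->
  flow F a y0 r i = y0 i + RInt (fun s => F i (flow F a y0 s)) 0 r.
Proof.
  intros Ha0 HM HB HL HL0 Ha Hr.
  pose proof (fun n r => flow_picard_close F M L a n y0 r Ha0 HM HB HL HL0 Ha) as Hc.
  apply cond_eq. intros e He.
  destruct (geometric_small (2 * (M * a)) e He) as [n Hn].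
  apply Rle_lt_trans with (2 := Hn).
  pose proof (Hc (S n) r Hr i) as H1. simpl picard in H1.
  assert (Hp : 0 <= 2 * (M * a) * (/ 2) ^ n).
  { apply Rmult_le_pos; [|apply pow_le; lra].
    pose proof (Rmult_le_pos M a HM Ha0). lra. }
  assert (H2 : Rabs (RInt (fun s => F i (picard F n y0 s)) 0 r
                     - RInt (fun s => F i (flow F a y0 s)) 0 r)
               <= L * (2 * (M * a) * (/ 2) ^ n) * Rabs r).
  { apply RInt_difference_le.
    - apply (lipschitz_curve_integrable F M L _ HL).
      now apply (picard_time_lipschitz F M L n).
    - apply (lipschitz_curve_integrable F M L _ HL). intros s s' j.
      replace (M * Rabs (s - s')) with (2 * 0 + M * Rabs (s - s')) by ring.
      apply (flow_lipschitz F M L a); auto using sup_close_refl.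
    - intros t Ht. apply HL. intros j. rewrite Rabs_minus_sym. apply Hc. lra. }
  assert (H3 : L * (2 * (M * a) * (/ 2) ^ n) * Rabs r <= 2 * (M * a) * (/ 2) ^ n * / 2).
  { apply Rle_trans with (L * (2 * (M * a) * (/ 2) ^ n) * a).
    - apply Rmult_le_compat_l; [now apply Rmult_le_pos | assumption].
    - apply Rmult_le_compat_r with (r := 2 * (M * a) * (/ 2) ^ n) in Ha; lra. }
  eapply Rle_trans;
    [apply Rabs_minus_triang with
       (y := y0 i + RInt (fun s => F i (picard F n y0 s)) 0 r)|].
  rewrite Rminus_plus_l_l. simpl in H1, H2 |- *. lra.
Qed.

Lemma flow_initial {I : Type} (F : I -> (I -> R) -> R) (M L a : R) y0 i :
  0 <= a -> 0 <= M -> bounded_by M F -> lipschitz L F -> 0 <= L -> L * a <= / 2 ->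
  flow F a y0 0 i = y0 i.
Proof.
  intros. rewrite (flow_equation F M L); auto; [|now rewrite Rabs_R0].
  rewrite RInt_point. apply Rplus_0_r.
Qed.

Lemma flow_derive {I : Type} (F : I -> (I -> R) -> R) (M L a : R) y0 r i :
  0 <= a -> 0 <= M -> bounded_by M F -> lipschitz L F -> 0 <= L -> L * a <= / 2 ->
  Rabs r < a ->
  is_derive (fun s : R => flow F a y0 s i) r (F i (flow F a y0 r)).
Proof.
  intros Ha0 HM HB HL HL0 Ha Hr.
  assert (Hlip : forall s s', sup_close (M * Rabs (s - s')) (flow F a y0 s) (flow F a y0 s')).
  { intros s s' j. replace (M * Rabs (s - s')) with (2 * 0 + M * Rabs (s - s')) by ring.
    apply (flow_lipschitz F M L a); auto using sup_close_refl. }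
  apply is_derive_ext_loc with
    (f := fun s => y0 i + RInt (fun s => F i (flow F a y0 s)) 0 s).
  - exists (mkposreal (a - Rabs r) (proj2 (Rlt_0_minus _ _) Hr)). intros s Hs.
    symmetry. apply (flow_equation F M L); auto.
    change (Rabs (s - r) < a - Rabs r) in Hs.
    pose proof (Rabs_triang_inv s r). lra.
  - rewrite <- (Rplus_0_l (F i (flow F a y0 r))).
    apply (is_derive_plus (fun _ => y0 i)); [apply @is_derive_const|].
    apply (is_derive_RInt (fun s => F i (flow F a y0 s)) _ 0).
    + apply filter_forall. intros s. apply (RInt_correct (V := R_CompleteNormedModule)).
      now apply (lipschitz_curve_integrable F M L).
    + now apply (lipschitz_curve_continuous F M L).
Qed.

Lemma flow_invariant {I : Type} (F : I -> (I -> R) -> R) (a : R) (K : I -> Prop)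
    (c : I -> R) y0 :
  (forall y, (forall i, K i -> y i = c i) -> forall i, K i -> F i y = 0) ->
  (forall i, K i -> y0 i = c i) ->
  forall r i, K i -> flow F a y0 r i = c i.
Proof.
  intros HF H0 r i Hi. unfold flow.
  rewrite (Lim_seq_ext _ (fun _ => c i)); [now rewrite Lim_seq_const|].
  intros n. now apply picard_invariant with (K := K).
Qed.

(** * Local flow of a field that is Lipschitz near a point *)

Definition lip_on {I : Type} (B : (I -> R) -> Prop) (g : (I -> R) -> R) : Prop :=
  exists M L, 0 <= M /\ 0 <= L /\ (forall y, B y -> Rabs (g y) <= M) /\
    (forall y z d, B y -> B z -> sup_close d y z -> Rabs (g y - g z) <= L * d).

Lemma lip_on_const {I : Type} (B : (I -> R) -> Prop) (k : R) : lip_on B (fun _ => k).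
Proof.
  exists (Rabs k), 0. repeat split; try lra; [apply Rabs_pos | intros; lra | intros].
  rewrite Rminus_diag, Rabs_R0. lra.
Qed.

Lemma lip_on_coord {I : Type} (c : I -> R) (rad : R) (i : I) :
  lip_on (fun y => sup_close rad y c) (fun y => y i).
Proof.
  exists (Rabs (c i) + Rabs rad), 1. pose proof (Rabs_pos (c i)). pose proof (Rabs_pos rad).
  repeat split; try lra.
  - intros y Hy. specialize (Hy i). pose proof (Rabs_triang_inv (y i) (c i)).
    pose proof (Rle_abs rad). lra.
  - intros y z d _ _ Hd. specialize (Hd i). lra.
Qed.

Lemma lip_on_plus {I : Type} (B : (I -> R) -> Prop) (g h : (I -> R) -> R) :
  lip_on B g -> lip_on B h -> lip_on B (fun y => g y + h y).
Proof.
  intros (M & L & HM & HL & Hg & Hg') (M' & L' & HM' & HL' & Hh & Hh').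
  exists (M + M'), (L + L'). repeat split; try lra.
  - intros y Hy. eapply Rle_trans; [apply Rabs_triang|].
    specialize (Hg y Hy). specialize (Hh y Hy). lra.
  - intros y z d Hy Hz Hd. specialize (Hg' y z d Hy Hz Hd). specialize (Hh' y z d Hy Hz Hd).
    replace (g y + h y - (g z + h z)) with ((g y - g z) + (h y - h z)) by ring.
    eapply Rle_trans; [apply Rabs_triang|]. lra.
Qed.

(** Bound and Lipschitz constant travel together in [lip_on] because the Lipschitz constant of a
    product involves the bounds of both factors. *)
Lemma lip_on_mult {I : Type} (B : (I -> R) -> Prop) (g h : (I -> R) -> R) :
  lip_on B g -> lip_on B h -> lip_on B (fun y => g y * h y).
Proof.
  intros (M & L & HM & HL & Hg & Hg') (M' & L' & HM' & HL' & Hh & Hh').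
  exists (M * M'), (M * L' + M' * L).
  pose proof (Rmult_le_pos _ _ HM HL'). pose proof (Rmult_le_pos _ _ HM' HL).
  repeat split; try lra; [now apply Rmult_le_pos| |].
  - intros y Hy. rewrite Rabs_mult.
    apply Rmult_le_compat; auto using Rabs_pos.
  - intros y z d Hy Hz Hd. specialize (Hg' y z d Hy Hz Hd). specialize (Hh' y z d Hy Hz Hd).
    replace (g y * h y - g z * h z) with (g y * (h y - h z) + h z * (g y - g z)) by ring.
    eapply Rle_trans; [apply Rabs_triang|]. rewrite !Rabs_mult.
    replace ((M * L' + M' * L) * d) with (M * (L' * d) + M' * (L * d)) by ring.
    apply Rplus_le_compat; apply Rmult_le_compat; auto using Rabs_pos.
Qed.

Lemma lip_on_inv {I : Type} (B : (I -> R) -> Prop) (g : (I -> R) -> R) (k : R) :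
  0 < k -> (forall y, B y -> k <= g y) -> lip_on B g -> lip_on B (fun y => / g y).
Proof.
  intros Hk Hgk (M & L & HM & HL & Hg & Hg').
  assert (Hi : forall y, B y -> Rabs (/ g y) <= / k).
  { intros y Hy. specialize (Hgk y Hy). rewrite Rabs_pos_eq.
    - apply Rinv_le_contravar; lra.
    - left; apply Rinv_0_lt_compat; lra. }
  assert (Hk' : 0 < / k) by now apply Rinv_0_lt_compat.
  exists (/ k), (/ k * / k * L). repeat split; try lra; auto.
  - apply Rmult_le_pos; [apply Rmult_le_pos|]; lra.
  - intros y z d Hy Hz Hd. specialize (Hg' y z d Hy Hz Hd).
    pose proof (Hgk y Hy). pose proof (Hgk z Hz).
    replace (/ g y - / g z) with (/ g y * / g z * (g z - g y)) by (field; lra).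
    rewrite !Rabs_mult, Rmult_assoc, (Rmult_assoc (/ k * / k)), (Rmult_assoc (/ k)).
    rewrite (Rabs_minus_sym (g z)).
    repeat (apply Rmult_le_compat; auto using Rabs_pos;
            try (apply Rmult_le_pos; apply Rabs_pos)).
Qed.

Lemma lip_on_opp {I : Type} (B : (I -> R) -> Prop) (g : (I -> R) -> R) :
  lip_on B g -> lip_on B (fun y => - g y).
Proof.
  intros (M & L & HM & HL & Hg & Hg'). exists M, L. repeat split; auto.
  - intros y Hy. rewrite Rabs_Ropp. auto.
  - intros y z d Hy Hz Hd. rewrite <- Rabs_Ropp, Ropp_minus_distr.
    replace (- g z - - g y) with (g y - g z) by ring. auto.
Qed.

Lemma lip_on_pow {I : Type} (B : (I -> R) -> Prop) (g : (I -> R) -> R) n :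
  lip_on B g -> lip_on B (fun y => g y ^ n).
Proof.
  intros Hg. induction n as [|n IH]; simpl; [apply lip_on_const | now apply lip_on_mult].
Qed.

Definition clamp_to {I : Type} (c : I -> R) (rad : R) (y : I -> R) (i : I) : R :=
  c i + clamp rad (y i - c i).

(** The field is precomposed with the coordinatewise clamp to the box around [c], which makes it
    globally bounded and Lipschitz. A solution that starts in the half-size box stays in the full
    one up to time [a]; there the clamp is the identity and the original equation holds. *)
Lemma local_flow {I : Type} (F : I -> (I -> R) -> R) (c : I -> R) (rad M L : R) :
  0 < rad ->
  (forall i y, sup_close rad y c -> Rabs (F i y) <= M) ->
  (forall i y z d, sup_close rad y c -> sup_close rad z c -> sup_close d y z ->
     Rabs (F i y - F i z) <= L * d) ->
  exists (a eta C : R) (Phi : (I -> R) -> R -> I -> R),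
    0 < a /\ 0 < eta /\ 0 <= C /\
    (forall y0 i, Phi y0 0 i = y0 i) /\
    (forall y0 z0 d r r', sup_close d y0 z0 ->
       sup_close (2 * d + C * Rabs (r - r')) (Phi y0 r) (Phi z0 r')) /\
    (forall y0 r, sup_close eta y0 c -> Rabs r <= a -> sup_close rad (Phi y0 r) c) /\
    (forall y0 r i, sup_close eta y0 c -> Rabs r < a ->
       is_derive (fun s : R => Phi y0 s i) r (F i (Phi y0 r))) /\
    (forall K : I -> Prop,
       (forall y, sup_close rad y c -> (forall i, K i -> y i = c i) ->
          forall i, K i -> F i y = 0) ->
       forall y0, (forall i, K i -> y0 i = c i) ->
       forall r i, K i -> Phi y0 r i = c i).
Proof.
  intros Hrad HM HL.
  set (M' := Rabs M + 1). set (L' := Rabs L + 1).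
  assert (HM' : 1 <= M') by (unfold M'; pose proof (Rabs_pos M); lra).
  assert (HL' : 1 <= L') by (unfold L'; pose proof (Rabs_pos L); lra).
  (* One bound keeps the displacement [M' * a] at most half the box, the other keeps the contraction
     factor [L' * a] at most one half. *)
  set (a := Rmin (rad / (2 * M')) (/ (2 * L'))).
  set (G := fun i y => F i (clamp_to c rad y)).
  assert (Hcl : forall y, sup_close rad (clamp_to c rad y) c).
  { intros y i. unfold clamp_to. rewrite Rplus_minus_l. apply clamp_abs; lra. }
  assert (Hcl' : forall y, sup_close rad y c -> forall i, clamp_to c rad y i = y i).
  { intros y Hy i. unfold clamp_to. rewrite clamp_id by apply Hy. ring. }
  assert (HB : bounded_by M' G).
  { intros i y. eapply Rle_trans; [now apply HM|]. unfold M'.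
    pose proof (Rle_abs M); lra. }
  assert (HG : lipschitz L' G).
  { intros i y z d Hd.
    assert (0 <= d) by (pose proof (Hd i); pose proof (Rabs_pos (y i - z i)); lra).
    apply Rle_trans with (L * d).
    - apply HL; auto. intros j. unfold clamp_to. rewrite Rminus_plus_l_l.
      eapply Rle_trans; [apply clamp_lipschitz; lra|].
      replace (y j - c j - (z j - c j)) with (y j - z j) by ring. apply Hd.
    - apply Rmult_le_compat_r; [lra|]. unfold L'. pose proof (Rle_abs L); lra. }
  assert (Ha : 0 < a).
  { unfold a. apply Rmin_pos; [apply Rdiv_lt_0_compat | apply Rinv_0_lt_compat]; lra. }
  assert (HaL : L' * a <= / 2).
  { replace (/ 2) with (L' * / (2 * L')) by (field; lra).
    apply Rmult_le_compat_l; [lra | apply Rmin_r]. }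
  assert (HaM : M' * a <= rad / 2).
  { replace (rad / 2) with (M' * (rad / (2 * M'))) by (field; lra).
    apply Rmult_le_compat_l; [lra | apply Rmin_l]. }
  assert (Hin : forall y0 r, sup_close (rad / 2) y0 c -> Rabs r <= a ->
            sup_close rad (flow G a y0 r) c).
  { intros y0 r H0 Hr i.
    pose proof (flow_lipschitz G M' L' a) as Hlip.
    specialize (Hlip ltac:(lra) ltac:(lra) HB HG ltac:(lra) HaL y0 y0 0 r 0
                  (sup_close_refl y0) i).
    rewrite (flow_initial G M' L' a) in Hlip by (auto; lra).
    rewrite Rminus_0_r in Hlip.
    assert (M' * Rabs r <= M' * a) by (apply Rmult_le_compat_l; lra).
    eapply Rle_trans; [apply Rabs_minus_triang with (y := y0 i)|].
    specialize (H0 i). lra. }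
  exists a, (rad / 2), M', (flow G a).
  do 3 (split; [lra|]).
  split; [|split; [|split; [exact Hin|split]]].
  - intros. apply (flow_initial G M' L' a); auto; lra.
  - intros. apply (flow_lipschitz G M' L' a); auto; lra.
  - intros y0 r i H0 Hr.
    (* The flow and its clamp agree coordinate by coordinate; the Lipschitz bound with [d = 0] turns
       this into equality of the field values without functional extensionality. *)
    assert (HF : F i (flow G a y0 r) = G i (flow G a y0 r)).
    { apply cond_eq. intros e He. apply Rle_lt_trans with (L * 0); [|lra].
      apply HL; [| now apply Hcl |]; [apply Hin; auto; lra|].
      intros j. rewrite Hcl' by (apply Hin; auto; lra).
      rewrite Rminus_diag, Rabs_R0; lra. }
    rewrite HF. apply (flow_derive G M' L' a); auto; lra.
  - intros K HK y0 H0 r i Hi. apply (flow_invariant G a K); auto.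
    (* The clamp fixes the centre, so a clamped state still equals [c] on [K]. *)
    intros y Hy j Hj. apply HK; auto. intros k Hk. unfold clamp_to.
    rewrite Hy, clamp_id by (auto; rewrite ?Hy, ?Rminus_diag, ?Rabs_R0; auto; lra). ring.
Qed.

(** * The desingularised equations *)

(* [Time], [Sigma], [Volume], [Ratio], [Omega1], [OmegaDiff] stand for t, f_1, f_1 f_2 f_3,
   f_2 / f_3, w_1 and w_2 - w_3, where w_i = tau_i - u f_i^2. *)
Inductive component : Set := Time | Sigma | Volume | Ratio | Omega1 | OmegaDiff.

(* w_2 and w_3 are solved from w_1 + w_2 + w_3 = 2 lambda V. *)
Definition omega (lambda : R) (i : index) (y : component -> R) : R :=
  match i with
  | One => y Omega1
  | Two => (2 * lambda * y Volume - y Omega1 + y OmegaDiff) / 2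
  | Three => (2 * lambda * y Volume - y Omega1 - y OmegaDiff) / 2
  end.

(* The soliton equations differentiated in r, where dt = f_1 dr. *)
Definition desing_field (lambda : R) (i : component) (y : component -> R) : R :=
  match i with
  | Time => y Sigma
  | Sigma =>
      y Omega1 / 3
      - y Sigma ^ 3 / 6
        * ((omega lambda Two y / y Ratio + omega lambda Three y * y Ratio) / y Volume)
      + y Sigma * (y Ratio + / y Ratio) / 2 - y Sigma ^ 4 / 2 / y Volume
  | Volume => (y Sigma ^ 3 + y Volume * (y Ratio + / y Ratio)) / 2
  | Ratio =>
      y Sigma ^ 2 * (omega lambda Two y - omega lambda Three y * y Ratio ^ 2) / 2
        / y Volume - (y Ratio ^ 2 - 1)
  | Omega1 => lambda * y Sigma ^ 3
  | OmegaDiff => lambda * y Volume * (y Ratio - / y Ratio)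
  end.

(* w_1 = -3 gives df_1/dr = -1 at r = 0. *)
Definition base_state (i : component) : R :=
  match i with
  | Volume | Ratio => 1
  | Omega1 => - 3
  | Time | Sigma | OmegaDiff => 0
  end.

Lemma desing_field_lip (lambda : R) (i : component) :
  lip_on (fun y => sup_close (/ 2) y base_state) (desing_field lambda i).
Proof.
  (* [Volume] and [Ratio], the only non-constant denominators of the field, are 1 at the centre and
     hence at least 1/2 in the box of radius 1/2. *)
  assert (Hhalf : forall j y, base_state j = 1 -> sup_close (/ 2) y base_state ->
                    / 2 <= y j).
  { intros j y Hj Hy. specialize (Hy j). rewrite Hj in Hy.
    apply Rabs_le_between in Hy. lra. }
  assert (HV : lip_on (fun y => sup_close (/ 2) y base_state) (fun y => / y Volume)).
  { apply lip_on_inv with (/ 2); [lra| |apply lip_on_coord]. intros; now apply Hhalf. }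
  assert (HR : lip_on (fun y => sup_close (/ 2) y base_state) (fun y => / y Ratio)).
  { apply lip_on_inv with (/ 2); [lra| |apply lip_on_coord]. intros; now apply Hhalf. }
  destruct i; unfold desing_field, omega, Rdiv, Rminus;
  repeat first
    [ assumption | apply lip_on_coord | apply lip_on_const | apply lip_on_plus
    | apply lip_on_opp | apply lip_on_pow | apply lip_on_mult ].
Qed.

Definition initial_state (p : R4) (i : component) : R :=
  match i with
  | Time | Sigma => 0
  | Volume => fst (fst p)
  | Ratio => snd (fst p)
  | Omega1 => fst (snd p)
  | OmegaDiff => snd (snd p)
  end.

Definition near_base (eta : R) (p : R4) : Prop :=
  (Rabs (fst (fst p) - 1) < eta /\ Rabs (snd (fst p) - 1) < eta) /\
  (Rabs (fst (snd p) - -3) < eta /\ Rabs (snd (snd p)) < eta).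

(** Clauses without [near_base] come from the cut-off flow, which is global. [C] bounds the speed of
    the state; [df_sigma_decr] is the quantitative form of w_1 < 0 from which the control of [t]
    follows. *)
Record desing_flow (lambda a eta C : R) (y : R4 -> R -> component -> R) : Prop := {
  df_a_pos : 0 < a;
  df_eta_pos : 0 < eta;
  df_C_pos : 0 <= C;
  df_initial : forall p i, y p 0 i = initial_state p i;
  df_lip : forall p p' d r r', sup_close d (initial_state p) (initial_state p') ->
    sup_close (2 * d + C * Rabs (r - r')) (y p r) (y p' r');
  df_box : forall p r, near_base eta p -> Rabs r <= a ->
    sup_close (/ 2) (y p r) base_state;
  df_sigma_decr : forall p r, near_base eta p -> Rabs r <= a ->
    desing_field lambda Sigma (y p r) <= - / 2;
  df_derive : forall p r i, near_base eta p -> Rabs r < a ->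
    is_derive (fun s : R => y p s i) r (desing_field lambda i (y p r));
  df_symmetric : forall p, snd (fst p) = 1 -> snd (snd p) = 0 ->
    forall r, y p r Ratio = 1 /\ y p r OmegaDiff = 0
}.

Lemma sup_close_le {I : Type} (d d' : R) (y z : I -> R) :
  d <= d' -> sup_close d y z -> sup_close d' y z.
Proof. intros Hd H i. specialize (H i). lra. Qed.

Lemma near_base_close (eta : R) (p : R4) : near_base eta p ->
  sup_close eta (initial_state p) base_state.
Proof.
  intros [[H1 H2] [H3 H4]].
  assert (0 <= eta) by (apply Rlt_le, Rle_lt_trans with (2 := H4), Rabs_pos).
  intros []; simpl; rewrite ?Rminus_0_r, ?Rabs_R0; auto using Rlt_le.
Qed.

Lemma desing_flow_exists (lambda : R) : exists a eta C y, desing_flow lambda a eta C y.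
Proof.
  assert (Hb : exists M L, 0 <= L /\
    (forall i y, sup_close (/ 2) y base_state -> Rabs (desing_field lambda i y) <= M) /\
    (forall i y z d, sup_close (/ 2) y base_state -> sup_close (/ 2) z base_state ->
       sup_close d y z ->
       Rabs (desing_field lambda i y - desing_field lambda i z) <= L * d)).
  { pose proof (desing_field_lip lambda) as H.
    destruct (H Time) as (M1 & L1 & ? & ? & HM1 & HL1).
    destruct (H Sigma) as (M2 & L2 & ? & ? & HM2 & HL2).
    destruct (H Volume) as (M3 & L3 & ? & ? & HM3 & HL3).
    destruct (H Ratio) as (M4 & L4 & ? & ? & HM4 & HL4).
    destruct (H Omega1) as (M5 & L5 & ? & ? & HM5 & HL5).
    destruct (H OmegaDiff) as (M6 & L6 & ? & ? & HM6 & HL6).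
    (* One pair of constants for all components: the summands are non-negative, so each sum
       dominates all of them. *)
    exists (M1 + M2 + M3 + M4 + M5 + M6), (L1 + L2 + L3 + L4 + L5 + L6).
    split; [lra|split].
    - intros i y Hy.
      destruct i; eapply Rle_trans; eauto; lra.
    - intros i y z d Hy Hz Hd.
      assert (0 <= d) by (pose proof (Hd i); pose proof (Rabs_pos (y i - z i)); lra).
      destruct i;
        (eapply Rle_trans;
         [ first [eapply HL1 | eapply HL2 | eapply HL3 | eapply HL4 | eapply HL5 | eapply HL6];
           eassumption
         | apply Rmult_le_compat_r; lra ]). }
  destruct Hb as (M & L & HL0 & HM & HL).
  (* The second bound makes [L * rad <= / 2], so the r-derivative of f_1, equal to -1 at the base
     state, is at most -1/2 in the whole box. *)
  set (rad := Rmin (/ 2) (/ (2 * (L + 1)))).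
  assert (Hrad : 0 < rad).
  { apply Rmin_pos; [|apply Rinv_0_lt_compat]; lra. }
  assert (Hrad2 : rad <= / 2) by apply Rmin_l.
  assert (HradL : L * rad <= / 2).
  { apply Rle_trans with ((L + 1) * rad); [apply Rmult_le_compat_r; lra|].
    replace (/ 2) with ((L + 1) * / (2 * (L + 1))) by (field; lra).
    apply Rmult_le_compat_l; [lra | apply Rmin_r]. }
  destruct (local_flow (desing_field lambda) base_state rad M L) as
    (a & eta & C & Phi & Ha & Heta & HC & Hinit & Hlip & Hbox & Hder & Hinv); auto.
  { intros i y Hy. apply HM. now apply sup_close_le with rad. }
  { intros i y z d Hy Hz. apply HL; now apply sup_close_le with rad. }
  exists a, eta, C, (fun p => Phi (initial_state p)).
  split; auto.
  - intros p r Hp Hr. apply sup_close_le with rad; auto using near_base_close.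
  - intros p r Hp Hr.
    assert (Hbase : desing_field lambda Sigma base_state = - 1).
    { simpl. field. }
    pose proof (Hbox _ _ (near_base_close _ _ Hp) Hr) as Hb.
    pose proof (HL Sigma _ base_state rad (sup_close_le _ _ _ _ Hrad2 Hb)) as Hd.
    rewrite Hbase in Hd. apply Rabs_le_between in Hd; [lra| |exact Hb].
    apply sup_close_le with 0; [lra | apply sup_close_refl].
  - intros p r i Hp Hr. apply Hder; auto using near_base_close.
  - intros p H1 H2 r.
    assert (H : forall i, i = Ratio \/ i = OmegaDiff ->
                  Phi (initial_state p) r i = base_state i).
    (* With rho = 1 and w_2 = w_3 the field has no component in these two directions. *)
    { apply (Hinv (fun i => i = Ratio \/ i = OmegaDiff)).
      - intros y Hy Hk.
        assert (HyR : y Ratio = 1) by (apply (Hk Ratio); auto).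
        assert (HyD : y OmegaDiff = 0) by (apply (Hk OmegaDiff); auto).
        intros i [-> | ->]; simpl; rewrite HyR, ?HyD; [|rewrite Rinv_1; ring].
        unfold Rdiv; ring.
      - intros i [-> | ->]; simpl; auto. }
    split; apply H; auto.
Qed.

(** * Inversion of the time change from r to t *)

Lemma desing_flow_continuous lambda a eta C y p i r :
  desing_flow lambda a eta C y -> continuous (fun s => y p s i) r.
Proof.
  intros H. apply (lipschitz_continuous C). intros s s'.
  replace (C * Rabs (s - s')) with (2 * 0 + C * Rabs (s - s')) by ring.
  apply (df_lip _ _ _ _ _ H). apply sup_close_refl.
Qed.

(** The derivative is asked for only inside the interval, because the flow equation is known for
    [Rabs r < a] while the estimates below are wanted up to [r = - a]. *)
Lemma MVT_le (f df : R -> R) (x z : R) :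
  x <= z -> (forall r, x < r < z -> is_derive f r (df r)) ->
  (forall r, continuous f r) -> (forall r, x <= r <= z -> 0 <= df r) -> f x <= f z.
Proof.
  intros Hxz Hd Hc Hp.
  destruct (MVT_gen f x z df) as (r & Hr & He);
    rewrite ?Rmin_left, ?Rmax_right in * by lra; auto.
  - intros r _. apply continuity_pt_filterlim, Hc.
  - specialize (Hp r Hr). assert (0 <= df r * (z - x)) by (apply Rmult_le_pos; lra). lra.
Qed.

(** f_1 is 0 at [r = 0] and decreases at rate at least 1/2, so going back from 0 it gains at least
    [- r / 2]. *)
Lemma sigma_lower lambda a eta C y p r :
  desing_flow lambda a eta C y -> near_base eta p -> - a <= r <= 0 ->
  - r / 2 <= y p r Sigma.
Proof.
  intros H Hp Hr.
  assert (Hm : - (y p r Sigma + r / 2) <= - (y p 0 Sigma + 0 / 2)).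
  { apply (MVT_le (fun s => - (y p s Sigma + s / 2))
             (fun s => - (desing_field lambda Sigma (y p s) + / 2))); [lra| | |].
    - intros s Hs. apply (is_derive_opp (fun s => y p s Sigma + s / 2)).
      apply (is_derive_plus (fun s => y p s Sigma)).
      + apply (df_derive _ _ _ _ _ H); auto. apply Rabs_def1; lra.
      + auto_derive; [trivial | field].
    - intros s. apply (continuous_opp (fun s => y p s Sigma + s / 2)).
      apply (continuous_plus (fun s => y p s Sigma)).
      + eapply desing_flow_continuous; eauto.
      + apply (ex_derive_continuous (fun s => s / 2)). auto_derive. trivial.
    - intros s Hs. pose proof (df_sigma_decr _ _ _ _ _ H p s Hp) as Hd.
      enough (desing_field lambda Sigma (y p s) <= - / 2) by lra.
      apply Hd, Rabs_le. lra. }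
  rewrite (df_initial _ _ _ _ _ H) in Hm. simpl in Hm. lra.
Qed.

(** Integration of dt/dr = f_1 >= -r/2. This quantitative monotonicity does the work of an inverse
    function theorem, uniformly up to [r = 0]. *)
Lemma time_increment lambda a eta C y p r s :
  desing_flow lambda a eta C y -> near_base eta p -> - a <= r -> r <= s -> s <= 0 ->
  (r ^ 2 - s ^ 2) / 4 <= y p s Time - y p r Time.
Proof.
  intros H Hp Hr Hrs Hs.
  enough (y p r Time + r ^ 2 / 4 <= y p s Time + s ^ 2 / 4) by lra.
  apply (MVT_le (fun s => y p s Time + s ^ 2 / 4) (fun s => y p s Sigma + s / 2)); auto.
  - intros x Hx. apply (is_derive_plus (fun s => y p s Time)).
    + apply (df_derive _ _ _ _ _ H p x Time); auto. apply Rabs_def1; lra.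
    + auto_derive; [trivial | field].
  - intros x. apply (continuous_plus (fun s => y p s Time)).
    + eapply desing_flow_continuous; eauto.
    + apply (ex_derive_continuous (fun s => s ^ 2 / 4)). auto_derive. trivial.
  - intros x Hx. pose proof (sigma_lower _ _ _ _ _ p x H Hp). lra.
Qed.

(* The inverse of r |-> t on [-a, 0], arbitrary for t outside [- a^2 / 4, 0]. *)
Definition clock (a : R) (y : R4 -> R -> component -> R) (p : R4) (t : R) : R :=
  epsilon (inhabits 0) (fun r => - a <= r <= 0 /\ y p r Time = t).

Lemma clock_spec lambda a eta C y p t :
  desing_flow lambda a eta C y -> near_base eta p -> - (a ^ 2 / 4) <= t <= 0 ->
  - a <= clock a y p t <= 0 /\ y p (clock a y p t) Time = t.
Proof.
  intros H Hp Ht. unfold clock. apply epsilon_spec.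
  pose proof (df_a_pos _ _ _ _ _ H) as Ha.
  (* The time is at most [- (a ^ 2 / 4)] at [r = - a] and 0 at [r = 0], so every [t] in the stated
     range is attained in between. *)
  pose proof (time_increment _ _ _ _ _ p (- a) 0 H Hp ltac:(lra) ltac:(lra) ltac:(lra)) as Hi.
  rewrite (df_initial _ _ _ _ _ H) in Hi. simpl initial_state in Hi.
  assert (Hz : y p 0 Time = 0) by apply (df_initial _ _ _ _ _ H).
  destruct (IVT_gen (fun r => y p r Time) (- a) 0 t) as (r & Hr & He).
  - intros r. apply continuity_pt_filterlim. eapply desing_flow_continuous; eauto.
  - rewrite Hz. rewrite Rmin_left, Rmax_right by nra. nra.
  - rewrite Rmin_left, Rmax_right in Hr by lra. now exists r.
Qed.

(* [time_increment] says that t + r^2/4 is increasing in r, so r^2 is a Lipschitz function of t *)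
Lemma clock_lip lambda a eta C y p p' d t t' :
  desing_flow lambda a eta C y -> near_base eta p -> near_base eta p' ->
  - (a ^ 2 / 4) <= t <= 0 -> - (a ^ 2 / 4) <= t' <= 0 ->
  sup_close d (initial_state p) (initial_state p') ->
  Rabs (clock a y p t) * Rabs (clock a y p t - clock a y p' t') <= 8 * d + 4 * Rabs (t - t').
Proof.
  intros H Hp Hp' Ht Ht' Hd.
  destruct (clock_spec _ _ _ _ _ p t H Hp Ht) as [Hr Hy].
  destruct (clock_spec _ _ _ _ _ p' t' H Hp' Ht') as [Hr' Hy'].
  set (r := clock a y p t) in *. set (r' := clock a y p' t') in *.
  (* Both parameters are compared at the same [r']: this costs [2 * d] and leaves a comparison of
     [r] with [r'] along the single solution of [p]. *)
  pose proof (df_lip _ _ _ _ _ H p p' d r' r' Hd Time) as Hl.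
  rewrite Rminus_diag, Rabs_R0, Hy' in Hl.
  pose proof (Rabs_minus_triang t t' (y p r' Time)) as Htri.
  rewrite (Rabs_minus_sym t' (y p r' Time)) in Htri.
  assert (Hsq : Rabs (r ^ 2 - r' ^ 2) / 4 <= Rabs (t - y p r' Time)).
  { destruct (Rle_dec r r') as [Hrr|Hrr].
    - pose proof (time_increment _ _ _ _ _ p r r' H Hp ltac:(lra) ltac:(lra) ltac:(lra)) as Hi.
      rewrite Hy in Hi. rewrite (Rabs_minus_sym t).
      rewrite (Rabs_pos_eq (r ^ 2 - r' ^ 2)) by nra.
      pose proof (Rle_abs (y p r' Time - t)). lra.
    - pose proof (time_increment _ _ _ _ _ p r' r H Hp ltac:(lra) ltac:(lra) ltac:(lra)) as Hi.
      rewrite Hy in Hi. rewrite (Rabs_minus_sym (r ^ 2)).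
      rewrite (Rabs_pos_eq (r' ^ 2 - r ^ 2)) by nra.
      pose proof (Rle_abs (t - y p r' Time)). lra. }
  assert (Rabs r * Rabs (r - r') <= Rabs (r ^ 2 - r' ^ 2)); [|lra].
  replace (r ^ 2 - r' ^ 2) with ((r + r') * (r - r')) by ring. rewrite Rabs_mult.
  (* Both numbers are non-positive, so [Rabs (r + r')] is at least [Rabs r]. *)
  apply Rmult_le_compat_r; [apply Rabs_pos|].
  rewrite !Rabs_left1 by lra. lra.
Qed.

Lemma clock_neg lambda a eta C y p t :
  desing_flow lambda a eta C y -> near_base eta p -> - (a ^ 2 / 4) < t < 0 ->
  - a < clock a y p t < 0.
Proof.
  intros H Hp Ht.
  destruct (clock_spec _ _ _ _ _ p t H Hp ltac:(lra)) as [[Hr1 Hr2] Hy].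
  assert (Hz : y p 0 Time = 0) by apply (df_initial _ _ _ _ _ H).
  pose proof (df_a_pos _ _ _ _ _ H) as Ha.
  pose proof (time_increment _ _ _ _ _ p (- a) 0 H Hp ltac:(lra) ltac:(lra) ltac:(lra)) as Hi.
  split.
  - destruct Hr1 as [Hr1|Hr1]; [exact Hr1|]. rewrite <- Hr1 in Hy. nra.
  - destruct Hr2 as [Hr2|Hr2]; [exact Hr2|]. rewrite Hr2 in Hy. lra.
Qed.

Lemma clock_sqrt lambda a eta C y p t :
  desing_flow lambda a eta C y -> near_base eta p -> - (a ^ 2 / 4) < t < 0 ->
  Rabs (clock a y p t) <= 2 * sqrt (- t).
Proof.
  intros H Hp Ht.
  destruct (clock_spec _ _ _ _ _ p t H Hp ltac:(lra)) as [Hr Hy].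
  pose proof (time_increment _ _ _ _ _ p _ 0 H Hp (proj1 Hr) (proj2 Hr) ltac:(lra)) as Hi.
  rewrite (df_initial _ _ _ _ _ H), Hy in Hi. simpl initial_state in Hi.
  rewrite Rabs_left1 by apply Hr.
  set (r := clock a y p t) in *.
  replace (- r) with (2 * (- r / 2)) by field. apply Rmult_le_compat_l; [lra|].
  rewrite <- (sqrt_pow2 (- r / 2)) by lra. apply sqrt_le_1_alt. nra.
Qed.

Lemma clock_increasing lambda a eta C y p t t' :
  desing_flow lambda a eta C y -> near_base eta p ->
  - (a ^ 2 / 4) <= t -> t <= t' -> t' <= 0 -> clock a y p t <= clock a y p t'.
Proof.
  intros H Hp Ht Htt' Ht'.
  destruct (clock_spec _ _ _ _ _ p t H Hp ltac:(lra)) as [Hr Hy].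
  destruct (clock_spec _ _ _ _ _ p t' H Hp ltac:(lra)) as [Hr' Hy'].
  apply Rnot_lt_le. intros Hlt.
  pose proof (time_increment _ _ _ _ _ p _ _ H Hp (proj1 Hr') (Rlt_le _ _ Hlt) (proj2 Hr)).
  nra.
Qed.

Lemma clock_continuous lambda a eta C y p t :
  desing_flow lambda a eta C y -> near_base eta p -> - (a ^ 2 / 4) < t < 0 ->
  continuity_pt (clock a y p) t.
Proof.
  intros H Hp Ht e He.
  pose proof (clock_neg _ _ _ _ _ p t H Hp Ht) as Hr.
  set (r := clock a y p t) in *.
  (* [clock_lip] with [d = 0] bounds the change of the clock by 4 |t - t'| / (-r), hence the last
     term; the other two keep [t'] where the clock inverts the time. *)
  exists (Rmin (Rmin (- t) (t + a ^ 2 / 4)) (e * - r / 5)). split.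
  - repeat apply Rmin_pos; nra.
  - intros t' [_ Hd]. unfold dist in *; simpl in *. unfold R_dist in *.
    pose proof (Rlt_le_trans _ _ _ Hd (Rmin_r _ _)) as Hd1.
    pose proof (Rlt_le_trans _ _ _ Hd (Rmin_l _ _)) as Hd2.
    pose proof (Rlt_le_trans _ _ _ Hd2 (Rmin_l _ _)) as Hd3.
    pose proof (Rlt_le_trans _ _ _ Hd2 (Rmin_r _ _)) as Hd4.
    pose proof (Rabs_def2 _ _ Hd3). pose proof (Rabs_def2 _ _ Hd4).
    pose proof (clock_lip _ _ _ _ _ p p 0 t t' H Hp Hp ltac:(simpl; lra) ltac:(simpl; lra)
                  (sup_close_refl _)) as Hl.
    fold r in Hl. rewrite (Rabs_left r), (Rabs_minus_sym t), (Rabs_minus_sym r) in Hl by lra.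
    nra.
Qed.

Lemma clock_derive lambda a eta C y p t :
  desing_flow lambda a eta C y -> near_base eta p -> - (a ^ 2 / 4) < t < 0 ->
  is_derive (clock a y p) t (/ y p (clock a y p t) Sigma).
Proof.
  intros H Hp Ht. pose proof (df_a_pos _ _ _ _ _ H) as Ha.
  pose proof (clock_neg _ _ _ _ _ p t H Hp Ht) as Hr.
  (* The rule for inverse functions wants a closed interval around [t]; its ends are the midpoints
     between [t] and the ends of the open range. *)
  set (lb := (t - a ^ 2 / 4) / 2). set (ub := t / 2).
  pose proof (clock_neg _ _ _ _ _ p lb H Hp ltac:(unfold lb; lra)) as Hlb.
  pose proof (clock_neg _ _ _ _ _ p ub H Hp ltac:(unfold ub; lra)) as Hub.
  assert (HT : forall r, clock a y p lb <= r <= clock a y p ub ->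
            derivable_pt_lim (fun s => y p s Time) r (y p r Sigma)).
  { intros r Hlr. apply is_derive_Reals.
    apply (df_derive _ _ _ _ _ H p r Time Hp). apply Rabs_def1; lra. }
  assert (Hmon : clock a y p lb <= clock a y p t <= clock a y p ub).
  { split; apply (clock_increasing _ _ _ _ _ p _ _ H Hp); unfold lb, ub; lra. }
  pose proof (sigma_lower _ _ _ _ _ p (clock a y p t) H Hp ltac:(lra)) as Hs.
  (* A derivability witness with explicit value, so that [derive_pt] computes to the [Sigma]
     component. *)
  set (Prf := fun r Hlr => exist (fun l => derivable_pt_abs (fun s => y p s Time) r l)
                             (y p r Sigma) (HT r Hlr)).
  pose proof (Ranalysis5.derivable_pt_lim_recip_interv (fun s => y p s Time)
    (clock a y p) lb ub t Prf) as Hrec.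
  apply is_derive_Reals.
  replace (/ y p (clock a y p t) Sigma) with (1 / y p (clock a y p t) Sigma) by (field; lra).
  apply (Hrec (clock_continuous _ _ _ _ _ p t H Hp Ht)) with (Prg_incr := Hmon);
    unfold lb, ub; try lra.
  - intros s Hsb. unfold comp, id.
    apply (clock_spec _ _ _ _ _ p s H Hp). lra.
  - unfold derive_pt, Prf; simpl. lra.
Qed.

(** The solutions in the time [t]. [ss_close] gives both the square root bound on f_1, whose initial
    value is 0, and the limits of all components. In [ss_continuous] the [d] may depend on [t],
    since control of the clock degenerates at [t = 0]. *)
Record soliton_states (lambda eta eps K : R) (z : R4 -> R -> component -> R) : Prop := {
  ss_eta_pos : 0 < eta;
  ss_eps_pos : 0 < eps;
  ss_close : forall p t i, near_base eta p -> - eps < t < 0 ->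
    Rabs (z p t i - initial_state p i) <= K * sqrt (- t);
  ss_box : forall p t, near_base eta p -> - eps < t < 0 ->
    sup_close (/ 2) (z p t) base_state;
  ss_sigma_pos : forall p t, near_base eta p -> - eps < t < 0 -> 0 < z p t Sigma;
  ss_derive : forall p t i, near_base eta p -> - eps < t < 0 ->
    is_derive (fun s : R => z p s i) t (desing_field lambda i (z p t) / z p t Sigma);
  ss_continuous : forall p t i e, near_base eta p -> - eps < t < 0 -> 0 < e ->
    exists d, 0 < d /\ forall p' t', near_base eta p' -> - eps < t' < 0 ->
      sup_close d (initial_state p) (initial_state p') -> Rabs (t - t') <= d ->
      Rabs (z p t i - z p' t' i) < e;
  ss_symmetric : forall p t, snd (fst p) = 1 -> snd (snd p) = 0 ->
    z p t Ratio = 1 /\ z p t OmegaDiff = 0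
}.

Lemma soliton_states_exist (lambda : R) :
  exists eta eps K z, soliton_states lambda eta eps K z.
Proof.
  destruct (desing_flow_exists lambda) as (a & eta & C & y & H).
  pose proof (df_a_pos _ _ _ _ _ H) as Ha.
  pose proof (df_C_pos _ _ _ _ _ H) as HC.
  exists eta, (a ^ 2 / 4), (2 * C), (fun p t => y p (clock a y p t)). split.
  - apply (df_eta_pos _ _ _ _ _ H).
  - nra.
  - intros p t i Hp Ht.
    pose proof (clock_sqrt _ _ _ _ _ p t H Hp Ht) as Hs.
    rewrite <- (df_initial _ _ _ _ _ H p i).
    eapply Rle_trans; [apply (df_lip _ _ _ _ _ H p p 0), sup_close_refl|].
    rewrite Rminus_0_r.
    apply Rmult_le_compat_l with (r := C) in Hs; lra.
  - intros p t Hp Ht. pose proof (clock_neg _ _ _ _ _ p t H Hp Ht).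
    apply (df_box _ _ _ _ _ H); auto. apply Rabs_le; lra.
  - intros p t Hp Ht. pose proof (clock_neg _ _ _ _ _ p t H Hp Ht).
    pose proof (sigma_lower _ _ _ _ _ p (clock a y p t) H Hp). lra.
  - intros p t i Hp Ht. pose proof (clock_neg _ _ _ _ _ p t H Hp Ht).
    unfold Rdiv. rewrite Rmult_comm.
    apply (is_derive_comp (fun s => y p s i) (clock a y p)).
    + apply (df_derive _ _ _ _ _ H p _ i Hp). apply Rabs_def1; lra.
    + now apply (clock_derive lambda a eta C).
  - intros p t i e Hp Ht He.
    pose proof (clock_neg _ _ _ _ _ p t H Hp Ht) as Hr.
    set (r := clock a y p t) in *.
    (* Multiplied by [- r], the change of the state is at most [a * (2 * d) + C * (12 * d)], the 12
       being 8 + 4 from [clock_lip]; [d] is chosen to make this at most [- r * (e / 2)]. *)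
    assert (HK : 0 < 2 * a + 12 * C + 1) by lra.
    exists (e * - r / 2 / (2 * a + 12 * C + 1)). set (d := _ / _ / _).
    assert (Hd : 0 < d).
    { unfold d. repeat apply Rdiv_lt_0_compat; nra. }
    assert (Hdk : (2 * a + 12 * C + 1) * d = e * - r / 2) by (unfold d; field; lra).
    split; [exact Hd|]. intros p' t' Hp' Ht' Hpd Htd.
    pose proof (clock_lip _ _ _ _ _ p p' d t t' H Hp Hp' ltac:(lra) ltac:(lra) Hpd) as Hl.
    fold r in Hl. rewrite (Rabs_left r) in Hl by lra.
    pose proof (df_lip _ _ _ _ _ H p p' d r (clock a y p' t') Hpd i) as Hy.
    set (D := Rabs (y p r i - y p' (clock a y p' t') i)) in *.
    set (E := Rabs (r - clock a y p' t')) in *.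
    assert (H1 : - r * D <= - r * (2 * d + C * E)) by (apply Rmult_le_compat_l; lra).
    assert (H2 : C * (- r * E) <= C * (12 * d)) by (apply Rmult_le_compat_l; lra).
    assert (H3 : - r * (2 * d) <= a * (2 * d)) by (apply Rmult_le_compat_r; lra).
    assert (H4 : - r * D <= - r * (e / 2)) by lra.
    apply Rmult_le_reg_l in H4; lra.
  - intros p t H1 H2. now apply (df_symmetric _ _ _ _ _ H).
Qed.

(** * Recovering the soliton *)

(** Higher derivatives are carried as witnesses instead of [Derive_n]: closure under products,
    inverses and roots is then an induction on the order, and an autonomous equation raises the
    order of its own solutions. *)
Fixpoint differentiable_on (n : nat) (a b : R) (g : R -> R) : Prop :=
  match n with
  | O => True
  | S n => exists g', (forall t, a < t < b -> is_derive g t (g' t)) /\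
             differentiable_on n a b g'
  end.

Lemma locally_interval (a b t : R) (P : R -> Prop) :
  a < t < b -> (forall s, a < s < b -> P s) -> locally t P.
Proof.
  intros Ht HP. generalize (open_and _ _ (open_gt a) (open_lt b) t Ht).
  apply filter_imp, HP.
Qed.

Lemma differentiable_on_ext n a b g h :
  (forall t, a < t < b -> g t = h t) -> differentiable_on n a b g ->
  differentiable_on n a b h.
Proof.
  intros Hgh. destruct n as [|n]; simpl; [trivial|]. intros (g' & Hg & Hn).
  exists g'. split; [|exact Hn]. intros t Ht.
  apply is_derive_ext_loc with g; auto. now apply locally_interval with a b.
Qed.

(** For the Leibniz rule: in [g' * h + g * h'] the undifferentiated factors have one order to
    spare. *)
Lemma differentiable_on_S n a b g :
  differentiable_on (S n) a b g -> differentiable_on n a b g.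
Proof.
  revert g. induction n as [|n IH]; intros g; [simpl; trivial|].
  intros (g' & Hg & Hn). exists g'. split; auto.
Qed.

Lemma differentiable_on_const n a b k : differentiable_on n a b (fun _ => k).
Proof.
  revert k. induction n as [|n IH]; intros k; simpl; [trivial|].
  exists (fun _ => 0). split; [|apply IH]. intros t _. apply @is_derive_const.
Qed.

Lemma differentiable_on_plus n a b g h :
  differentiable_on n a b g -> differentiable_on n a b h ->
  differentiable_on n a b (fun t => g t + h t).
Proof.
  revert g h. induction n as [|n IH]; intros g h; simpl; [trivial|].
  intros (g' & Hg & Hg') (h' & Hh & Hh'). exists (fun t => g' t + h' t).
  split; [|auto]. intros t Ht. apply @is_derive_plus; auto.
Qed.

Lemma differentiable_on_mult n a b g h :
  differentiable_on n a b g -> differentiable_on n a b h ->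
  differentiable_on n a b (fun t => g t * h t).
Proof.
  revert g h. induction n as [|n IH]; intros g h Hg Hh; [simpl; trivial|].
  pose proof (differentiable_on_S _ _ _ _ Hg). pose proof (differentiable_on_S _ _ _ _ Hh).
  destruct Hg as (g' & Hg & Hg'). destruct Hh as (h' & Hh & Hh').
  exists (fun t => g' t * h t + g t * h' t).
  split; [|apply differentiable_on_plus; auto]. intros t Ht.
  apply (is_derive_mult g h t (g' t) (h' t)); auto using Rmult_comm.
Qed.

Lemma differentiable_on_opp n a b g :
  differentiable_on n a b g -> differentiable_on n a b (fun t => - g t).
Proof.
  intros Hg. apply differentiable_on_ext with (fun t => -1 * g t).
  - intros; ring.
  - apply differentiable_on_mult; [apply differentiable_on_const | exact Hg].
Qed.

Lemma differentiable_on_pow n m a b g :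
  differentiable_on n a b g -> differentiable_on n a b (fun t => g t ^ m).
Proof.
  intros Hg. induction m as [|m IH]; simpl.
  - apply differentiable_on_const.
  - now apply differentiable_on_mult.
Qed.

(** The derivative is written through [g'] and [/ g] itself, which has the lower order by the
    induction hypothesis; the square root below works in the same way. *)
Lemma differentiable_on_inv n a b g :
  (forall t, a < t < b -> g t <> 0) ->
  differentiable_on n a b g -> differentiable_on n a b (fun t => / g t).
Proof.
  intros H0. induction n as [|n IH]; intros Hg; [simpl; trivial|].
  pose proof (differentiable_on_S _ _ _ _ Hg) as Hg0. destruct Hg as (g' & Hg & Hg').
  exists (fun t => - (g' t * (/ g t) ^ 2)). split.
  - intros t Ht. replace (- (g' t * (/ g t) ^ 2)) with (- g' t / g t ^ 2)
      by (field; auto). apply is_derive_inv; auto.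
  - now apply differentiable_on_opp, differentiable_on_mult, differentiable_on_pow, IH.
Qed.

Lemma differentiable_on_sqrt n a b g :
  (forall t, a < t < b -> 0 < g t) ->
  differentiable_on n a b g -> differentiable_on n a b (fun t => sqrt (g t)).
Proof.
  intros H0. induction n as [|n IH]; intros Hg; [simpl; trivial|].
  pose proof (differentiable_on_S _ _ _ _ Hg) as Hg0. destruct Hg as (g' & Hg & Hg').
  exists (fun t => g' t * / (2 * sqrt (g t))). split.
  - intros t Ht. apply is_derive_sqrt; auto.
  - apply differentiable_on_mult; [exact Hg'|]. apply differentiable_on_inv.
    + intros t Ht. pose proof (sqrt_lt_R0 _ (H0 t Ht)). lra.
    + apply differentiable_on_mult; [apply differentiable_on_const | auto].
Qed.

(** The [m] orders held in reserve let the induction on [n] spend one of them at each step. *)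
Lemma differentiable_on_Derive_n n m a b g :
  differentiable_on (n + m) a b g ->
  exists h, differentiable_on m a b h /\ forall t, a < t < b -> Derive_n g n t = h t.
Proof.
  revert m. induction n as [|n IH]; intros m Hg.
  - now exists g.
  - destruct (IH (S m)) as (h & (h' & Hh & Hh') & He).
    { now rewrite Nat.add_succ_r. }
    exists h'. split; [exact Hh'|]. intros t Ht. simpl.
    apply is_derive_unique, is_derive_ext_loc with h; auto.
    apply locally_interval with a b; auto. intros; symmetry; auto.
Qed.

Lemma smooth_on_differentiable (a b : R) (g : R -> R) :
  (forall n, differentiable_on n a b g) -> smooth_on a b g.
Proof.
  intros Hg [|n] t Ht; simpl; [trivial|].
  destruct (differentiable_on_Derive_n n 1 a b g (Hg _)) as (h & (h' & Hh & _) & He).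
  exists (h' t). apply is_derive_ext_loc with h; auto.
  apply locally_interval with a b; auto. intros; symmetry; auto.
Qed.

(** The f_i^2, read off from f_2 f_3 = V / f_1 and f_2 / f_3 = rho. *)
Definition scale_sq (i : index) (y : component -> R) : R :=
  match i with
  | One => y Sigma ^ 2
  | Two => y Volume * y Ratio / y Sigma
  | Three => y Volume / y Ratio / y Sigma
  end.

(* The value of u forced by closedness. *)
Definition drift (lambda : R) (y : component -> R) : R :=
  - (omega lambda One y / scale_sq One y + omega lambda Two y / scale_sq Two y
     + omega lambda Three y / scale_sq Three y) / 3.

Record trajectory (lambda a b : R) (z : R -> component -> R) : Prop := {
  traj_sigma : forall t, a < t < b -> 0 < z t Sigma;
  traj_volume : forall t, a < t < b -> 0 < z t Volume;
  traj_ratio : forall t, a < t < b -> 0 < z t Ratio;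
  traj_derive : forall t i, a < t < b ->
    is_derive (fun s : R => z s i) t (desing_field lambda i (z t) / z t Sigma)
}.

Definition scale (z : R -> component -> R) (i : index) (t : R) : R :=
  sqrt (scale_sq i (z t)).

Lemma scale_sq_pos (y : component -> R) (i : index) :
  0 < y Sigma -> 0 < y Volume -> 0 < y Ratio -> 0 < scale_sq i y.
Proof.
  intros. destruct i; simpl.
  - nra.
  - apply Rdiv_lt_0_compat; [apply Rmult_lt_0_compat|]; assumption.
  - repeat apply Rdiv_lt_0_compat; assumption.
Qed.

Lemma trajectory_scale_sq_pos lambda a b z t i :
  trajectory lambda a b z -> a < t < b -> 0 < scale_sq i (z t).
Proof.
  intros H Ht. apply scale_sq_pos;
    [apply (traj_sigma _ _ _ _ H) | apply (traj_volume _ _ _ _ H) | apply (traj_ratio _ _ _ _ H)];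
    exact Ht.
Qed.

Lemma scale_pow2 lambda a b z t i :
  trajectory lambda a b z -> a < t < b -> scale z i t ^ 2 = scale_sq i (z t).
Proof.
  intros H Ht. apply pow2_sqrt, Rlt_le. eapply trajectory_scale_sq_pos; eauto.
Qed.

Lemma trajectory_vol lambda a b z t :
  trajectory lambda a b z -> a < t < b -> vol (scale z) t = z t Volume.
Proof.
  intros H Ht. unfold vol, scale.
  pose proof (traj_sigma _ _ _ _ H t Ht). pose proof (traj_volume _ _ _ _ H t Ht).
  pose proof (traj_ratio _ _ _ _ H t Ht).
  pose proof (scale_sq_pos (z t) One ltac:(auto) ltac:(auto) ltac:(auto)).
  pose proof (scale_sq_pos (z t) Two ltac:(auto) ltac:(auto) ltac:(auto)).
  rewrite <- sqrt_mult_alt, <- sqrt_mult_alt by (try apply Rmult_le_pos; lra).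
  rewrite <- (sqrt_pow2 (z t Volume)) at 1 by lra. f_equal. simpl. field. lra.
Qed.

Lemma trajectory_sqsum lambda a b z t :
  trajectory lambda a b z -> a < t < b ->
  sqsum (scale z) t = scale_sq One (z t) + scale_sq Two (z t) + scale_sq Three (z t).
Proof.
  intros H Ht. unfold sqsum. now rewrite !(scale_pow2 lambda a b) by assumption.
Qed.

(** [desing_field] encodes these three equations solved for f_1, V and rho, with u eliminated by
    closedness, so what remains is an identity of rational functions. *)
Lemma scale_sq_derive lambda a b z t i :
  trajectory lambda a b z -> a < t < b ->
  is_derive (fun s : R => scale_sq i (z s)) t
    (omega lambda i (z t) + drift lambda (z t) * scale_sq i (z t)
     - scale_sq i (z t) / z t Volume
       * (2 * scale_sq i (z t)
          - (scale_sq One (z t) + scale_sq Two (z t) + scale_sq Three (z t)))).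
Proof.
  intros H Ht.
  pose proof (traj_sigma _ _ _ _ H t Ht). pose proof (traj_volume _ _ _ _ H t Ht).
  pose proof (traj_ratio _ _ _ _ H t Ht).
  pose proof (fun i => traj_derive _ _ _ _ H t i Ht) as Hd.
  (* Opaque names for the coordinates let [auto_derive] see plain functions of one variable; the
     equations recorded before [clearbody] lead back to [z t]. *)
  pose (s := fun r => z r Sigma). pose (v := fun r => z r Volume).
  pose (q := fun r => z r Ratio).
  assert (Es : s t = z t Sigma) by reflexivity.
  assert (Ev : v t = z t Volume) by reflexivity.
  assert (Eq : q t = z t Ratio) by reflexivity.
  assert (Hs : is_derive s t (desing_field lambda Sigma (z t) / z t Sigma)) by apply Hd.
  assert (Hv : is_derive v t (desing_field lambda Volume (z t) / z t Sigma)) by apply Hd.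
  assert (Hq : is_derive q t (desing_field lambda Ratio (z t) / z t Sigma)) by apply Hd.
  destruct i;
    [ change (fun r => scale_sq One (z r)) with (fun r => s r ^ 2)
    | change (fun r => scale_sq Two (z r)) with (fun r => v r * q r / s r)
    | change (fun r => scale_sq Three (z r)) with (fun r => v r / q r / s r) ];
    clearbody s v q;
    (auto_derive; [repeat split; try (eexists; eassumption); lra|]);
    rewrite ?(is_derive_unique (fun r : R => s r) _ _ Hs),
      ?(is_derive_unique (fun r : R => v r) _ _ Hv), ?(is_derive_unique (fun r : R => q r) _ _ Hq),
      ?Es, ?Ev, ?Eq;
    unfold drift, desing_field, omega, scale_sq; field; lra.
Qed.

(** For [Two] and [Three], closedness 2 V' = S turns lambda V' - lambda x_1 / 2 +- lambda (x_2 -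
    x_3) / 2 into lambda x_2 or lambda x_3. *)
Lemma omega_derive lambda a b z t i :
  trajectory lambda a b z -> a < t < b ->
  is_derive (fun s : R => omega lambda i (z s)) t (lambda * scale_sq i (z t)).
Proof.
  intros H Ht.
  pose proof (traj_sigma _ _ _ _ H t Ht). pose proof (traj_volume _ _ _ _ H t Ht).
  pose proof (traj_ratio _ _ _ _ H t Ht).
  pose proof (fun i => traj_derive _ _ _ _ H t i Ht) as Hd.
  pose (v := fun r => z r Volume). pose (o := fun r => z r Omega1).
  pose (d := fun r => z r OmegaDiff).
  assert (Hv : is_derive v t (desing_field lambda Volume (z t) / z t Sigma)) by apply Hd.
  assert (Ho : is_derive o t (desing_field lambda Omega1 (z t) / z t Sigma)) by apply Hd.
  assert (Hdd : is_derive d t (desing_field lambda OmegaDiff (z t) / z t Sigma)) by apply Hd.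
  destruct i;
    [ change (fun r => omega lambda One (z r)) with (fun r => o r)
    | change (fun r => omega lambda Two (z r))
        with (fun r => (2 * lambda * v r - o r + d r) / 2)
    | change (fun r => omega lambda Three (z r))
        with (fun r => (2 * lambda * v r - o r - d r) / 2) ];
    clearbody v o d;
    (auto_derive; [repeat split; eexists; eassumption|]);
    rewrite ?(is_derive_unique (fun r : R => v r) _ _ Hv),
      ?(is_derive_unique (fun r : R => o r) _ _ Ho), ?(is_derive_unique (fun r : R => d r) _ _ Hdd);
    unfold desing_field, scale_sq; field; lra.
Qed.

(** This identifies the state components w_i with the tau_i - u f_i^2 of the reconstructed soliton,
    so that evolution and conservation become statements about [omega]. *)
Lemma trajectory_omega lambda a b z t i :
  trajectory lambda a b z -> a < t < b ->
  tau (scale z) i t - drift lambda (z t) * scale z i t ^ 2 = omega lambda i (z t).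
Proof.
  intros H Ht. unfold tau.
  rewrite (trajectory_vol lambda a b), (trajectory_sqsum lambda a b),
    (scale_pow2 lambda a b) by assumption.
  rewrite (Derive_ext_loc _ (fun s : R => scale_sq i (z s))).
  - rewrite (is_derive_unique _ _ _ (scale_sq_derive lambda a b z t i H Ht)). ring.
  - apply locally_interval with a b; auto. intros s Hs. now apply (scale_pow2 lambda a b).
Qed.

(** Bootstrap: the right-hand side of the equation is a rational function of the state, so it has
    every order that the state has. *)
Lemma trajectory_differentiable lambda a b z n i :
  trajectory lambda a b z -> differentiable_on n a b (fun t => z t i).
Proof.
  intros H. revert i. induction n as [|n IH]; intros i; [simpl; trivial|].
  exists (fun t => desing_field lambda i (z t) / z t Sigma).
  split; [intros t Ht; now apply (traj_derive _ _ _ _ H)|].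
  assert (Hs : differentiable_on n a b (fun t => / z t Sigma)).
  { apply differentiable_on_inv; auto.
    intros t Ht. pose proof (traj_sigma _ _ _ _ H t Ht). lra. }
  assert (Hv : differentiable_on n a b (fun t => / z t Volume)).
  { apply differentiable_on_inv; auto.
    intros t Ht. pose proof (traj_volume _ _ _ _ H t Ht). lra. }
  assert (Hr : differentiable_on n a b (fun t => / z t Ratio)).
  { apply differentiable_on_inv; auto.
    intros t Ht. pose proof (traj_ratio _ _ _ _ H t Ht). lra. }
  destruct i; unfold desing_field, omega, Rdiv, Rminus;
    repeat first
      [ assumption | apply IH | apply differentiable_on_const | apply differentiable_on_plus
      | apply differentiable_on_opp | apply differentiable_on_pow
      | apply differentiable_on_mult ].
Qed.

Lemma scale_sq_differentiable lambda a b z n i :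
  trajectory lambda a b z -> differentiable_on n a b (fun t => scale_sq i (z t)).
Proof.
  intros H. pose proof (fun i => trajectory_differentiable lambda a b z n i H) as Hz.
  destruct i; unfold scale_sq, Rdiv;
    repeat first
      [ apply Hz | apply differentiable_on_pow | apply differentiable_on_mult
      | apply differentiable_on_inv; [intros t Ht|] ].
  - pose proof (traj_sigma _ _ _ _ H t Ht). lra.
  - pose proof (traj_ratio _ _ _ _ H t Ht). lra.
  - pose proof (traj_sigma _ _ _ _ H t Ht). lra.
Qed.

Lemma drift_differentiable lambda a b z n :
  trajectory lambda a b z -> differentiable_on n a b (fun t => drift lambda (z t)).
Proof.
  intros H. pose proof (fun i => trajectory_differentiable lambda a b z n i H) as Hz.
  assert (Hx : forall i, differentiable_on n a b (fun t => / scale_sq i (z t))).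
  { intros i. apply differentiable_on_inv; [|now apply scale_sq_differentiable with lambda].
    intros t Ht. pose proof (trajectory_scale_sq_pos _ _ _ _ t i H Ht). lra. }
  unfold drift, omega, Rdiv, Rminus;
    repeat first
      [ apply Hz | apply Hx | apply differentiable_on_const | apply differentiable_on_plus
      | apply differentiable_on_opp | apply differentiable_on_mult ].
Qed.

Lemma trajectory_soliton lambda a b z :
  trajectory lambda a b z ->
  SU3_soliton lambda a b (scale z) (fun t => drift lambda (z t)).
Proof.
  intros H. split.
  - intros i t Ht. apply sqrt_lt_R0. eapply trajectory_scale_sq_pos; eauto.
  - intros i. apply smooth_on_differentiable. intros n.
    apply differentiable_on_sqrt; [|now apply scale_sq_differentiable with lambda].
    intros t Ht. eapply trajectory_scale_sq_pos; eauto.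
  - apply smooth_on_differentiable. intros n. now apply drift_differentiable.
  - intros t Ht. rewrite (trajectory_sqsum lambda a b) by assumption.
    rewrite (Derive_ext_loc _ (fun s : R => z s Volume)).
    + rewrite (is_derive_unique _ _ _ (traj_derive _ _ _ _ H t Volume Ht)).
      pose proof (traj_sigma _ _ _ _ H t Ht). pose proof (traj_ratio _ _ _ _ H t Ht).
      simpl. field. lra.
    + apply locally_interval with a b; auto. intros s Hs.
      now apply (trajectory_vol lambda a b).
  - intros i t Ht. rewrite (scale_pow2 lambda a b) by assumption.
    rewrite (Derive_ext_loc _ (fun s : R => omega lambda i (z s))).
    + now apply is_derive_unique, (omega_derive lambda a b).
    + apply locally_interval with a b; auto. intros s Hs.
      now apply (trajectory_omega lambda a b).
  - intros t Ht.
    (* The conservation law is built into [omega], whose three values add up to 2 lambda V. *)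
    pose proof (fun i => trajectory_omega lambda a b z t i H Ht) as Ho.
    pose proof (Ho One) as H1. pose proof (Ho Two) as H2. pose proof (Ho Three) as H3.
    unfold omega in H1, H2, H3.
    rewrite (trajectory_vol lambda a b) by assumption. unfold sqsum. lra.
Qed.

(** * Behaviour at the collapsing end *)

Lemma at_left_0_interval (e : R) (P : R -> Prop) :
  0 < e -> (forall t, - e < t < 0 -> P t) -> at_left 0 P.
Proof.
  intros He HP. exists (mkposreal e He). intros t Ht Ht0.
  change (Rabs (t - 0) < e) in Ht. apply Rabs_def2 in Ht. apply HP. lra.
Qed.

Lemma at_left_0_eventually_locally (P : R -> Prop) :
  at_left 0 P -> exists e, 0 < e /\ forall t, - e < t < 0 -> P t.
Proof.
  intros [e He]. exists e. split; [apply cond_pos|]. intros t Ht. apply He; [|lra].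
  change (Rabs (t - 0) < e). apply Rabs_def1; lra.
Qed.

Lemma filterlim_at_left_sqrt (g : R -> R) (l K e : R) :
  0 < e -> (forall t, - e < t < 0 -> Rabs (g t - l) <= K * sqrt (- t)) ->
  filterlim g (at_left 0) (locally l).
Proof.
  intros He Hg. apply filterlim_locally. intros d.
  assert (HK : 0 < Rabs K + 1) by (pose proof (Rabs_pos K); lra).
  set (m := d / (Rabs K + 1)).
  assert (Hm : 0 < m) by (apply Rdiv_lt_0_compat; [apply cond_pos | exact HK]).
  apply at_left_0_interval with (Rmin e (m ^ 2)).
  - apply Rmin_pos; [exact He | now apply pow_lt].
  - intros t Ht. pose proof (Rmin_l e (m ^ 2)). pose proof (Rmin_r e (m ^ 2)).
    assert (Hs : sqrt (- t) < m).
    { rewrite <- (sqrt_pow2 m) by lra. apply sqrt_lt_1_alt. lra. }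
    change (Rabs (g t - l) < d).
    eapply Rle_lt_trans; [apply Hg; lra|].
    apply Rle_lt_trans with ((Rabs K + 1) * sqrt (- t)).
    + apply Rmult_le_compat_r; [apply sqrt_pos|]. pose proof (Rle_abs K). lra.
    + replace (pos d) with ((Rabs K + 1) * m) by (unfold m; field; lra).
      now apply Rmult_lt_compat_l.
Qed.

Lemma near_base_volume_ratio (y : component -> R) :
  sup_close (/ 2) y base_state -> 0 < y Volume /\ 0 < y Ratio.
Proof.
  intros H. pose proof (H Volume) as H1. pose proof (H Ratio) as H2. simpl in H1, H2.
  apply Rabs_le_between in H1. apply Rabs_le_between in H2. lra.
Qed.

Lemma soliton_states_trajectory lambda eta eps K z p :
  soliton_states lambda eta eps K z -> near_base eta p ->
  trajectory lambda (- eps) 0 (z p).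
Proof.
  intros H Hp. split.
  - intros t Ht. now apply (ss_sigma_pos _ _ _ _ _ H).
  - intros t Ht. apply (near_base_volume_ratio (z p t)), (ss_box _ _ _ _ _ H); auto.
  - intros t Ht. apply (near_base_volume_ratio (z p t)), (ss_box _ _ _ _ _ H); auto.
  - intros t i Ht. now apply (ss_derive _ _ _ _ _ H).
Qed.

Lemma soliton_states_limit lambda eta eps K z p i :
  soliton_states lambda eta eps K z -> near_base eta p ->
  filterlim (fun t => z p t i) (at_left 0) (locally (initial_state p i)).
Proof.
  intros H Hp. apply filterlim_at_left_sqrt with K eps; [apply (ss_eps_pos _ _ _ _ _ H)|].
  intros t Ht. now apply (ss_close _ _ _ _ _ H).
Qed.

Lemma soliton_states_limit_eq lambda eta eps K z p i (g : R -> R) (l : R) :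
  soliton_states lambda eta eps K z -> near_base eta p ->
  at_left 0 (fun t => z p t i = g t) -> filterlim g (at_left 0) (locally l) ->
  initial_state p i = l.
Proof.
  intros H Hp He Hg.
  apply (filterlim_locally_unique (V := R_NormedModule) (F := at_left 0) (fun t => z p t i)).
  - now apply soliton_states_limit with lambda eta eps K.
  - apply filterlim_ext_loc with g; [|exact Hg].
    revert He. apply filter_imp. auto.
Qed.

Lemma scale_sigma lambda a b z t :
  trajectory lambda a b z -> a < t < b -> scale z One t = z t Sigma.
Proof. intros H Ht. apply sqrt_pow2, Rlt_le, (traj_sigma _ _ _ _ H), Ht. Qed.

Lemma scale_ratio lambda a b z t :
  trajectory lambda a b z -> a < t < b ->
  scale z Two t / scale z Three t = z t Ratio.
Proof.
  intros H Ht. unfold scale.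
  pose proof (traj_sigma _ _ _ _ H t Ht). pose proof (traj_volume _ _ _ _ H t Ht).
  pose proof (traj_ratio _ _ _ _ H t Ht).
  rewrite <- sqrt_div_alt by (apply scale_sq_pos; assumption).
  rewrite <- (sqrt_pow2 (z t Ratio)) at 1 by lra. f_equal. simpl. field. lra.
Qed.

(** Nothing in [soliton_states] bounds [eta] from above, so positivity is drawn from the box: the
    lower bound 1/2 along the solution passes to the limit. *)
Lemma soliton_states_initial_pos lambda eta eps K z p :
  soliton_states lambda eta eps K z -> near_base eta p ->
  0 < initial_state p Volume /\ 0 < initial_state p Ratio.
Proof.
  intros H Hp.
  assert (Hge : forall i, base_state i = 1 -> / 2 <= initial_state p i).
  { intros i Hi.
    apply (filterlim_le (F := at_left 0) (fun _ => / 2) (fun t => z p t i)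
             (Finite (/ 2)) (Finite (initial_state p i))).
    - apply at_left_0_interval with eps; [apply (ss_eps_pos _ _ _ _ _ H)|].
      intros t Ht. pose proof (ss_box _ _ _ _ _ H p t Hp Ht i) as Hb.
      rewrite Hi in Hb. apply Rabs_le_between in Hb. lra.
    - apply filterlim_const.
    - now apply soliton_states_limit with lambda eta eps K. }
  pose proof (Hge Volume eq_refl). pose proof (Hge Ratio eq_refl). lra.
Qed.

Lemma soliton_states_collapse lambda eta eps K z p :
  soliton_states lambda eta eps K z -> near_base eta p ->
  collapses_at_0 One (scale (z p)).
Proof.
  intros H Hp.
  pose proof (ss_eps_pos _ _ _ _ _ H) as Heps.
  pose proof (soliton_states_trajectory _ _ _ _ _ p H Hp) as Ht.
  pose proof (soliton_states_initial_pos _ _ _ _ _ p H Hp) as [HV HR].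
  assert (Hratio : filterlim (fun t => scale (z p) Two t / scale (z p) Three t)
                     (at_left 0) (locally (initial_state p Ratio))).
  { apply filterlim_ext_loc with (fun t => z p t Ratio).
    - apply at_left_0_interval with eps; auto. intros t Hte. symmetry.
      now apply (scale_ratio lambda (- eps) 0).
    - now apply soliton_states_limit with lambda eta eps K. }
  split; [|split; [|split]].
  - apply filterlim_ext_loc with (fun t => z p t Sigma).
    + apply at_left_0_interval with eps; auto. intros t Hte. symmetry.
      now apply (scale_sigma lambda (- eps) 0).
    + now apply (soliton_states_limit lambda eta eps K z p Sigma).
  - exists K. apply at_left_0_interval with eps; auto. intros t Hte.
    rewrite (scale_sigma lambda (- eps) 0) by assumption.
    pose proof (ss_close _ _ _ _ _ H p t Sigma Hp Hte) as Hc. simpl in Hc.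
    now rewrite Rminus_0_r in Hc.
  - intros [] [] Hij Hi Hj; try congruence.
    + now exists (initial_state p Ratio).
    + exists (/ initial_state p Ratio). split; [now apply Rinv_0_lt_compat|].
      apply filterlim_ext_loc with (fun t => / (scale (z p) Two t / scale (z p) Three t)).
      * apply at_left_0_interval with eps; auto. intros t Hte. apply Rinv_div.
      * eapply filterlim_comp; [exact Hratio|].
        apply (continuous_Rinv (initial_state p Ratio)). lra.
  - exists (initial_state p Volume). split; [exact HV|].
    apply filterlim_ext_loc with (fun t => z p t Volume).
    + apply at_left_0_interval with eps; auto. intros t Hte. symmetry.
      now apply (trajectory_vol lambda (- eps) 0).
    + now apply soliton_states_limit with lambda eta eps K.
Qed.

(** * Transfer to the other collapsing directions by symmetry *)

Definition swap (k i : index) : index :=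
  match k, i with
  | Two, One => Two
  | Two, Two => One
  | Three, One => Three
  | Three, Three => One
  | _, i => i
  end.

Lemma swap_involutive (k i : index) : swap k (swap k i) = i.
Proof. now destruct k, i. Qed.

Definition permuted (k : index) (f : index -> R -> R) : index -> R -> R :=
  fun i => f (swap k i).

Lemma vol_permuted k f t : vol (permuted k f) t = vol f t.
Proof. destruct k; unfold vol, permuted; simpl; ring. Qed.

Lemma sqsum_permuted k f t : sqsum (permuted k f) t = sqsum f t.
Proof. destruct k; unfold sqsum, permuted; simpl; ring. Qed.

Lemma tau_permuted k f i t : tau (permuted k f) i t = tau f (swap k i) t.
Proof. unfold tau. now rewrite vol_permuted, sqsum_permuted. Qed.

Lemma SU3_soliton_permuted k lambda a b f u :
  SU3_soliton lambda a b f u -> SU3_soliton lambda a b (permuted k f) u.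
Proof.
  intros H. split.
  - intros i. apply (soliton_pos _ _ _ _ _ H).
  - intros i. apply (soliton_smooth_f _ _ _ _ _ H).
  - apply (soliton_smooth_u _ _ _ _ _ H).
  - intros t Ht. rewrite sqsum_permuted, <- (soliton_closed _ _ _ _ _ H t Ht).
    f_equal. apply Derive_ext. intros s. apply vol_permuted.
  - intros i t Ht. change (permuted k f i) with (f (swap k i)).
    rewrite <- (soliton_evolution _ _ _ _ _ H (swap k i) t Ht).
    apply Derive_ext. intros s. now rewrite tau_permuted.
  - intros t Ht. rewrite !tau_permuted, vol_permuted, sqsum_permuted.
    rewrite <- (soliton_conservation _ _ _ _ _ H t Ht).
    destruct k; simpl; ring.
Qed.

Lemma collapses_permuted k f :
  collapses_at_0 One f -> collapses_at_0 k (permuted k f).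
Proof.
  intros (H1 & H2 & H3 & l & Hl & H4).
  assert (Hk : swap k k = One) by now destruct k.
  split; [|split; [|split]].
  - unfold permuted. now rewrite Hk.
  - unfold permuted. now rewrite Hk.
  - intros i j Hij Hik Hjk. apply (H3 (swap k i) (swap k j));
      intros E; rewrite <- ?Hk in E; apply (f_equal (swap k)) in E;
      rewrite ?swap_involutive in E; auto.
  - exists l. split; [exact Hl|].
    apply filterlim_ext with (vol f); [|exact H4]. intros t. symmetry. apply vol_permuted.
Qed.

Definition permuted_family {P : UniformSpace} (k : index) (F : soliton_family P) :
    soliton_family P :=
  {| params := params F;
     fam_eps := fam_eps F;
     fam_f := fun p => permuted k (fam_f F p);
     fam_u := fam_u F |}.

Lemma parameter_family_permuted {P : UniformSpace} k (F : soliton_family P) :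
  is_parameter_family F -> is_parameter_family (permuted_family k F).
Proof.
  intros [H1 H2 H3 H4 H5 H6 H7]. split; auto.
  - intros i q Hq. now apply (H5 (swap k i)).
  - intros p p' Hp Hp' He. apply H7; auto. revert He. apply filter_imp.
    intros t [Hf Hu]. split; [|exact Hu]. intros i.
    specialize (Hf (swap k i)). simpl in Hf. unfold permuted in Hf.
    now rewrite swap_involutive in Hf.
Qed.

(** Openness and continuity are inherited by composition with the map that sends (v, t) to (j v, t);
    injectivity of [j] keeps distinct parameters distinct. *)
Lemma parameter_family_reparametrize {P Q : UniformSpace} (F : soliton_family P)
    (j : Q -> P) :
  is_parameter_family F -> (forall v, continuous j v) ->
  (forall v v', j v = j v' -> v = v') -> (exists v, params F (j v)) ->
  is_parameter_family (reparametrize F (fun v => params F (j v)) j).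
Proof.
  intros [H1 H2 H3 H4 H5 H6 H7] Hj Hinj Hne.
  assert (Hjt : forall q : Q * R, continuous (fun q : Q * R => (j (fst q), snd q)) q).
  { intros q. apply (continuous_comp_2 (fun q : Q * R => j (fst q)) snd pair).
    - apply (continuous_comp fst j); [|apply Hj]. destruct q. apply continuous_fst.
    - destruct q. apply continuous_snd.
    - apply (continuous_ext (fun x : P * R => x)); [now intros [? ?] | apply continuous_id]. }
  split; simpl; auto.
  - apply open_comp; auto. intros v _. apply Hj.
  - apply (open_comp (fun q : Q * R => (j (fst q), snd q)) (total_domain F)); auto.
    intros q _. apply Hjt.
  - intros i q Hq.
    apply (continuous_comp (fun q : Q * R => (j (fst q), snd q))
             (fun q : P * R => fam_f F (fst q) i (snd q))); auto.
  - intros q Hq.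
    apply (continuous_comp (fun q : Q * R => (j (fst q), snd q))
             (fun q : P * R => fam_u F (fst q) (snd q))); auto.
Qed.

(** * The parameter families *)

Definition base_family (lambda eta eps : R) (z : R4 -> R -> component -> R) :
    soliton_family R4 :=
  {| params := near_base eta;
     fam_eps := fun _ => eps;
     fam_f := fun p => scale (z p);
     fam_u := fun p t => drift lambda (z p t) |}.

Lemma initial_state_continuous (i : component) (p : R4) :
  continuous (fun p => initial_state p i) p.
Proof.
  destruct p as [p1 p2].
  destruct i; simpl; try apply continuous_const.
  - apply (continuous_comp fst fst); [|destruct p1]; apply continuous_fst.
  - apply (continuous_comp fst snd); [|destruct p1]; [apply continuous_fst | apply continuous_snd].
  - apply (continuous_comp snd fst); [|destruct p2]; [apply continuous_snd | apply continuous_fst].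
  - apply (continuous_comp snd snd); [|destruct p2]; apply continuous_snd.
Qed.

Lemma near_base_open (eta : R) : open (near_base eta).
Proof.
  assert (Hi : forall i c, open (fun p : R4 => Rabs (initial_state p i - c) < eta)).
  { intros i c. apply (open_comp (fun p : R4 => Rabs (initial_state p i - c)) (fun x => x < eta)).
    - intros p _. apply (continuous_comp (fun p => initial_state p i - c) Rabs).
      + apply (continuous_minus (V := R_NormedModule) (fun p => initial_state p i) (fun _ => c)).
        * apply initial_state_continuous.
        * apply continuous_const.
      + apply continuous_Rabs.
    - apply open_lt. }
  apply open_ext with (fun p : R4 =>
    (Rabs (initial_state p Volume - 1) < eta /\ Rabs (initial_state p Ratio - 1) < eta) /\
    (Rabs (initial_state p Omega1 - -3) < eta /\ Rabs (initial_state p OmegaDiff - 0) < eta)).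
  - intros p. unfold near_base. simpl. now rewrite Rminus_0_r.
  - repeat apply open_and; apply Hi.
Qed.

Lemma base_domain_open lambda eta eps z : open (total_domain (base_family lambda eta eps z)).
Proof.
  apply open_and.
  - apply (open_comp fst (near_base eta)); [|apply near_base_open].
    intros [p t] _. apply continuous_fst.
  - apply (open_comp snd (fun t => - eps < t < 0)).
    + intros [p t] _. apply continuous_snd.
    + apply open_and; [apply open_gt | apply open_lt].
Qed.

Lemma soliton_states_continuous lambda eta eps K z i (q : R4 * R) :
  soliton_states lambda eta eps K z -> total_domain (base_family lambda eta eps z) q ->
  continuous (fun q : R4 * R => z (fst q) (snd q) i) q.
Proof.
  intros H Hq. apply filterlim_locally. intros e.
  destruct (ss_continuous _ _ _ _ _ H (fst q) (snd q) i e (proj1 Hq) (proj2 Hq) (cond_pos e))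
    as (d & Hd & Hc).
  generalize (filter_and _ _ (base_domain_open lambda eta eps z q Hq)
                (locally_ball q (mkposreal d Hd))).
  apply filter_imp. intros q' [[Hp' Ht'] [[[B1 B2] [B3 B4]] Bt]].
  change (Rabs (z (fst q') (snd q') i - z (fst q) (snd q) i) < e).
  rewrite Rabs_minus_sym. apply Hc; auto.
  (* A ball in [R4 * R] bounds each coordinate separately; the [Time] and [Sigma] entries of initial
     states always agree. *)
  - intros []; simpl; rewrite ?Rminus_diag, ?Rabs_R0; try (now apply Rlt_le);
      rewrite Rabs_minus_sym; apply Rlt_le; assumption.
  - rewrite Rabs_minus_sym. apply Rlt_le. exact Bt.
Qed.

Lemma base_family_scale_sq_continuous lambda eta eps K z i (q : R4 * R) :
  soliton_states lambda eta eps K z -> total_domain (base_family lambda eta eps z) q ->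
  continuous (fun q : R4 * R => scale_sq i (z (fst q) (snd q))) q.
Proof.
  intros H Hq.
  pose proof (fun i => soliton_states_continuous lambda eta eps K z i q H Hq) as Hz.
  pose proof (soliton_states_trajectory _ _ _ _ _ _ H (proj1 Hq)) as Ht.
  pose proof (traj_sigma _ _ _ _ Ht _ (proj2 Hq)). pose proof (traj_ratio _ _ _ _ Ht _ (proj2 Hq)).
  assert (Hs : continuous (fun q : R4 * R => / z (fst q) (snd q) Sigma) q).
  { apply (continuous_comp (fun q : R4 * R => z (fst q) (snd q) Sigma) Rinv); auto.
    apply continuous_Rinv. lra. }
  assert (Hr : continuous (fun q : R4 * R => / z (fst q) (snd q) Ratio) q).
  { apply (continuous_comp (fun q : R4 * R => z (fst q) (snd q) Ratio) Rinv); auto.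
    apply continuous_Rinv. lra. }
  destruct i; simpl; unfold Rdiv.
  - apply (continuous_mult (K := R_AbsRing)); auto.
    apply (continuous_mult (K := R_AbsRing)); auto using continuous_const.
  - apply (continuous_mult (K := R_AbsRing)); auto.
    apply (continuous_mult (K := R_AbsRing)); auto.
  - apply (continuous_mult (K := R_AbsRing)); auto.
    apply (continuous_mult (K := R_AbsRing)); auto.
Qed.

Lemma base_family_drift_continuous lambda eta eps K z (q : R4 * R) :
  soliton_states lambda eta eps K z -> total_domain (base_family lambda eta eps z) q ->
  continuous (fun q : R4 * R => drift lambda (z (fst q) (snd q))) q.
Proof.
  intros H Hq.
  pose proof (fun i => soliton_states_continuous lambda eta eps K z i q H Hq) as Hz.
  pose proof (soliton_states_trajectory _ _ _ _ _ _ H (proj1 Hq)) as Ht.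
  assert (Hx : forall i, continuous (fun q : R4 * R => / scale_sq i (z (fst q) (snd q))) q).
  { intros i.
    apply (continuous_comp (fun q : R4 * R => scale_sq i (z (fst q) (snd q))) Rinv).
    - now apply base_family_scale_sq_continuous with lambda eta eps K.
    - apply continuous_Rinv.
      pose proof (trajectory_scale_sq_pos _ _ _ _ _ i Ht (proj2 Hq)). lra. }
  unfold drift, omega, Rdiv, Rminus;
    repeat lazymatch goal with
      | |- continuous (fun _ => ?c) _ => apply continuous_const
      | |- continuous (fun q => - @?f q) _ => apply (continuous_opp (V := R_NormedModule) f)
      | |- continuous (fun q => @?f q + @?g q) _ =>
          apply (continuous_plus (V := R_NormedModule) f g)
      | |- continuous (fun q => @?f q * @?g q) _ =>
          apply (continuous_mult (K := R_AbsRing) f g)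
      | |- continuous (fun q => / _) _ => apply Hx
      | |- _ => apply Hz
      end.
Qed.

Lemma initial_state_injective (p p' : R4) :
  (forall i, initial_state p i = initial_state p' i) -> p = p'.
Proof.
  intros H. destruct p as [[p1 p2] [p3 p4]], p' as [[q1 q2] [q3 q4]].
  pose proof (H Volume) as H1. pose proof (H Ratio) as H2.
  pose proof (H Omega1) as H3. pose proof (H OmegaDiff) as H4. simpl in *.
  now subst.
Qed.

Lemma tau_ext a b f g i t :
  a < t < b -> (forall s, a < s < b -> forall i, f i s = g i s) -> tau f i t = tau g i t.
Proof.
  intros Ht Hfg. unfold tau, vol, sqsum. rewrite !(Hfg t Ht). f_equal.
  apply Derive_ext_loc, locally_interval with a b; auto.
  intros s Hs. now rewrite Hfg.
Qed.

(** The values of f give f_1, V and rho; their equality on a whole interval gives also the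
    derivatives inside tau, hence, with u, the w_i. So the states agree near 0, and their limits are
    the initial states. *)
Lemma base_family_states_determined lambda eta eps K z p p' :
  soliton_states lambda eta eps K z -> near_base eta p -> near_base eta p' ->
  at_left 0 (fun t => (forall i, scale (z p) i t = scale (z p') i t) /\
                      drift lambda (z p t) = drift lambda (z p' t)) ->
  p = p'.
Proof.
  intros H Hp Hp' He.
  destruct (at_left_0_eventually_locally _ He) as (e & He0 & Heq).
  pose proof (ss_eps_pos _ _ _ _ _ H) as Heps.
  pose proof (soliton_states_trajectory _ _ _ _ _ p H Hp) as Ht.
  pose proof (soliton_states_trajectory _ _ _ _ _ p' H Hp') as Ht'.
  set (m := Rmin e eps).
  assert (Hm : 0 < m) by now apply Rmin_pos.
  assert (Hme : m <= e) by apply Rmin_l. assert (Hmeps : m <= eps) by apply Rmin_r.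
  assert (Hom : forall t i, - m < t < 0 -> omega lambda i (z p t) = omega lambda i (z p' t)).
  { intros t i Hti.
    rewrite <- (trajectory_omega lambda (- eps) 0 (z p)) by (auto; lra).
    rewrite <- (trajectory_omega lambda (- eps) 0 (z p')) by (auto; lra).
    rewrite (tau_ext (- m) 0 (scale (z p)) (scale (z p'))); auto.
    - destruct (Heq t) as [Hs Hu]; [lra|]. now rewrite Hs, Hu.
    - intros s Hs j. apply Heq. lra. }
  (* [Time] is set apart because it is not expressed through f and u; its initial value is 0 for
     every parameter. *)
  assert (Hz : forall t i, i <> Time -> - m < t < 0 -> z p t i = z p' t i).
  { intros t i Hi Hti.
    pose proof (Hom t One Hti) as O1. pose proof (Hom t Two Hti) as O2.
    pose proof (Hom t Three Hti) as O3. unfold omega in O1, O2, O3.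
    destruct (Heq t) as [Hs _]; [lra|].
    assert (HV : z p t Volume = z p' t Volume).
    { rewrite <- (trajectory_vol lambda (- eps) 0 (z p)) by (auto; lra).
      unfold vol. rewrite !Hs. apply (trajectory_vol lambda (- eps) 0); auto; lra. }
    rewrite HV in O2, O3.
    destruct i; [congruence | | exact HV | | exact O1 | lra].
    - rewrite <- (scale_sigma lambda (- eps) 0 (z p)) by (auto; lra).
      rewrite Hs. apply (scale_sigma lambda (- eps) 0); auto; lra.
    - rewrite <- (scale_ratio lambda (- eps) 0 (z p)) by (auto; lra).
      rewrite !Hs. apply (scale_ratio lambda (- eps) 0); auto; lra. }
  apply initial_state_injective. intros i.
  assert (Hi : i = Time \/ i <> Time) by (destruct i; auto; right; discriminate).
  destruct Hi as [-> | Hi]; [reflexivity|].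
  apply (soliton_states_limit_eq lambda eta eps K z p i (fun t => z p' t i)); auto.
  - apply at_left_0_interval with m; auto.
  - now apply soliton_states_limit with lambda eta eps K.
Qed.

Lemma base_family_parameter_family lambda eta eps K z :
  soliton_states lambda eta eps K z -> is_parameter_family (base_family lambda eta eps z).
Proof.
  intros H. split.
  - apply near_base_open.
  - exists ((1, 1), (-3, 0)). pose proof (ss_eta_pos _ _ _ _ _ H).
    split; simpl; rewrite !Rminus_diag, !Rabs_R0; auto.
  - intros p _. apply (ss_eps_pos _ _ _ _ _ H).
  - apply base_domain_open.
  - intros i q Hq.
    apply (continuous_comp (fun q : R4 * R => scale_sq i (z (fst q) (snd q))) sqrt);
      [|apply continuous_sqrt].
    now apply base_family_scale_sq_continuous with lambda eta eps K.
  - intros q Hq. now apply (base_family_drift_continuous lambda eta eps K z q).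
  - intros p p' Hp Hp'. now apply (base_family_states_determined lambda eta eps K z p p').
Qed.

(** * The subfamily with f_2 = f_3 *)

Definition symmetric_parameter (v : R2) : R4 := ((fst v, 1), (snd v, 0)).

Lemma symmetric_parameter_continuous (v : R2) : continuous symmetric_parameter v.
Proof.
  apply filterlim_locally. intros e. exists e. intros v' [H1 H2].
  repeat split; simpl; try assumption; apply ball_center.
Qed.

Lemma tau_Two_Three a b f t :
  a < t < b -> (forall s, a < s < b -> f Two s = f Three s) ->
  tau f Two t = tau f Three t.
Proof.
  intros Ht Hf. unfold tau. rewrite (Hf t Ht). f_equal.
  apply Derive_ext_loc, locally_interval with a b; auto.
  intros s Hs. now rewrite Hf.
Qed.

(** Along the solution f_2 = f_3 forces rho = 1 and also tau_2 = tau_3, whence w_2 = w_3; both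
    identities pass to the initial state in the limit. *)
Lemma equal_scales_symmetric lambda eta eps K z p :
  soliton_states lambda eta eps K z -> near_base eta p ->
  (forall t, - eps < t < 0 -> scale (z p) Two t = scale (z p) Three t) ->
  snd (fst p) = 1 /\ snd (snd p) = 0.
Proof.
  intros H Hp He.
  pose proof (ss_eps_pos _ _ _ _ _ H) as Heps.
  pose proof (soliton_states_trajectory _ _ _ _ _ p H Hp) as Ht.
  split.
  - apply (soliton_states_limit_eq lambda eta eps K z p Ratio (fun _ => 1)); auto.
    + apply at_left_0_interval with eps; auto. intros t Hte.
      rewrite <- (scale_ratio lambda (- eps) 0) by assumption. rewrite He by assumption.
      apply Rdiv_diag. apply Rgt_not_eq, sqrt_lt_R0.
      now apply (trajectory_scale_sq_pos lambda (- eps) 0).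
    + apply filterlim_const.
  - apply (soliton_states_limit_eq lambda eta eps K z p OmegaDiff (fun _ => 0)); auto.
    + apply at_left_0_interval with eps; auto. intros t Hte.
      pose proof (trajectory_omega _ _ _ _ t Two Ht Hte) as O2.
      pose proof (trajectory_omega _ _ _ _ t Three Ht Hte) as O3.
      rewrite (tau_Two_Three (- eps) 0), He in O2 by assumption.
      unfold omega in O2, O3. lra.
    + apply filterlim_const.
Qed.

Theorem theorem3 :
  forall lambda : R,
  exists F : index -> soliton_family R4,
    (forall k : index,
       is_parameter_family (F k) /\
       forall p : R4, params (F k) p ->
         SU3_soliton lambda (- fam_eps (F k) p) 0 (fam_f (F k) p) (fam_u (F k) p) /\
         collapses_at_0 k (fam_f (F k) p))
    /\
    (exists (V : R2 -> Prop) (j : R2 -> R4),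
       (forall p : R4,
          (exists v : R2, V v /\ j v = p) <->
          (params (F One) p /\
           forall t : R, - fam_eps (F One) p < t < 0 ->
             fam_f (F One) p Two t = fam_f (F One) p Three t)) /\
       is_parameter_family (reparametrize (F One) V j) /\
       forall v : R2, V v ->
         Sp2_soliton lambda (- fam_eps (F One) (j v)) 0
           (fam_f (F One) (j v)) (fam_u (F One) (j v))).
Proof.
  intros lambda. destruct (soliton_states_exist lambda) as (eta & eps & K & z & H).
  set (F0 := base_family lambda eta eps z).
  pose proof (base_family_parameter_family _ _ _ _ _ H) as HF0. fold F0 in HF0.
  assert (Hsol : forall k p, near_base eta p ->
            SU3_soliton lambda (- eps) 0 (permuted k (scale (z p)))
              (fun t => drift lambda (z p t))).
  { intros k p Hp. apply SU3_soliton_permuted, trajectory_soliton.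
    now apply soliton_states_trajectory with eta K. }
  (* With rho = 1 both squares equal V / f_1, at every [t]. *)
  assert (Hsym : forall v t, scale (z (symmetric_parameter v)) Two t
                             = scale (z (symmetric_parameter v)) Three t).
  { intros v t. destruct (ss_symmetric _ _ _ _ _ H (symmetric_parameter v) t) as [HR _];
      [reflexivity..|].
    unfold scale, scale_sq. rewrite HR. f_equal. unfold Rdiv. rewrite Rinv_1. ring. }
  exists (fun k => permuted_family k F0). split.
  - intros k. split; [now apply parameter_family_permuted|]. intros p Hp.
    split; [now apply Hsol|].
    now apply collapses_permuted, (soliton_states_collapse lambda eta eps K).
  - exists (fun v => near_base eta (symmetric_parameter v)), symmetric_parameter.
    split; [|split].
    + intros p. split.
      * intros (v & Hv & <-). split; [exact Hv|]. intros t _. apply Hsym.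
      * intros [Hp He].
        destruct (equal_scales_symmetric lambda eta eps K z p H Hp He) as [H1 H2].
        destruct p as [[p1 p2] [p3 p4]]. simpl in H1, H2. subst p2 p4.
        exists (p1, p3). now split.
    + apply (parameter_family_reparametrize (permuted_family One F0)).
      * now apply parameter_family_permuted.
      * apply symmetric_parameter_continuous.
      * intros [v1 v2] [w1 w2] E. injection E. intros; now subst.
      (* The base state, with V = 1 and w_1 = -3. *)
      * exists (1, -3). pose proof (ss_eta_pos _ _ _ _ _ H).
        split; simpl; rewrite !Rminus_diag, !Rabs_R0; auto.
    + intros v Hv. split; [now apply (Hsol One)|].
      intros t Ht. split; [apply Hsym|].
      apply (tau_Two_Three (- eps) 0); [exact Ht|]. intros s _. apply Hsym.
Qed.
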